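(* Let $\mathcal T\subseteq\mathcal H$ be a finite-dimensional subspace, let $K>0$, and let $\Omega=\{\omega_1<\dots<\omega_N\}$ be $(K,\delta)$-dense, where $$\delta<\sqrt{1-E(\mathcal T,K-1/2)^2}.$$ Let $\mathcal S$ be the weighted sampling operator $$\mathcal S f(x)=\sum_{n=1}^N \mu_n\hat f(\omega_n)e^{2\pi i\omega_n x}\mathbb 1_{[0,1]}(x),\qquad \mu_n=\tfrac12(\omega_{n+1}-\omega_{n-1}),$$ with the convention $\omega_0=\omega_N-2K$, $\omega_{N+1}=\omega_1+2K$. Then $\mathcal S$ is an admissible sampling operator for the pair $(\Omega,\mathcal T)$, and its reconstruction constant satisfies $$C(\Omega,\mathcal T)\le\frac{1+\delta}{\sqrt{1-E(\mathcal T,K-1/2)^2}-\delta}.$$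
   Context: For $f\in L^2(\mathbb R)$, $\hat f(\omega)=\int_{\mathbb R}f(x)e^{-2\pi i\omega x}\,dx$; $\langle\cdot,\cdot\rangle$ and $\|\cdot\|$ are the $L^2(\mathbb R)$ inner product and norm, and for a measurable $J\subseteq\mathbb R$, $\|g\|_J^2=\int_J|g|^2$. Let $\mathcal H=\{f\in L^2(\mathbb R):\operatorname{supp}f\subseteq[0,1]\}$. $(K,\delta)$-density: for $K>0$ and $0<\delta<1$, a finite set $\Omega=\{\omega_1<\dots<\omega_N\}\subset\mathbb R$ is $(K,\delta)$-dense if $\Omega\subseteq[-K,K]$ and $\max_{n=0,\dots,N}(\omega_{n+1}-\omega_n)\le\delta$, where $\omega_0=\omega_N-2K$, $\omega_{N+1}=\omega_1+2K$. $z$-residual: for $\mathcal T\subseteq\mathcal H$ and $z\ge0$, $E(\mathcal T,z)=\sup\{\|\hat f\|_{\mathbb R\setminus(-z,z)}: f\in\mathcal T,\ \|f\|=1\}$. Admissibility: a bounded linear operator $\mathcal S:\mathcal H\to\mathcal H$ is admissible for $(\Omega,\mathcal T)$ if (i) for each $f\in\mathcal H$, $\mathcal Sf$ depends only on the data $\{\hat f(\omega):\omega\in\Omega\}$; (ii) $\mathcal S$ is self-adjoint and $|\langle\mathcal Sf,g\rangle|\le\sqrt{\langle\mathcal Sf,f\rangle\langle\mathcal Sg,g\rangle}$ for all $f,g\in\mathcal H$; (iii) there is $C_1>0$ with $\langle\mathcal Sf,f\rangle\ge C_1\|f\|^2$ for all $f\in\mathcal T$. Constants: $C_1(\Omega,\mathcal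 T)$ is the largest constant with $\langle\mathcal Sf,f\rangle\ge C_1\|f\|^2$ for all $f\in\mathcal T$; $C_2(\Omega)$ is the smallest constant with $\langle\mathcal Sf,f\rangle\le C_2\|f\|^2$ for all $f\in\mathcal H$; the reconstruction constant is $C(\Omega,\mathcal T)=\sqrt{C_2(\Omega)/C_1(\Omega,\mathcal T)}$. *)

(* Defs.v *)
From HB Require Import structures.
From mathcomp Require Import all_boot all_order all_algebra.
From mathcomp Require Import all_classical all_reals all_analysis.
From mathcomp Require Import complex.

Set Implicit Arguments.
Unset Strict Implicit.
Unset Printing Implicit Defensive.

Import Order.TTheory GRing.Theory Num.Theory.
Local Open Scope classical_set_scope.
Local Open Scope ring_scope.

Section Defs.
Variable R : realType.

Local Notation C := (complex R).
Local Notation leb := (@lebesgue_measure R).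

Definition csq (z : C) : R := complex.Re z ^+ 2 + complex.Im z ^+ 2.
Definition cabs (z : C) : R := Num.sqrt (csq z).
Definition cconj (z : C) : C := Complex (complex.Re z) (- complex.Im z).
Definition cexpi (t : R) : C := Complex (cos t) (sin t).

Definition cint (D : set R) (h : R -> C) : C :=
  Complex (Rintegral leb D (fun x => complex.Re (h x)))
          (Rintegral leb D (fun x => complex.Im (h x))).

Definition L2 (f : R -> C) : Prop :=
  measurable_fun setT (fun x => complex.Re (f x)) /\
  measurable_fun setT (fun x => complex.Im (f x)) /\
  (\int[leb]_x (csq (f x))%:E < +oo)%E.

(* H = { f in L^2(R) : supp f ⊆ [0,1] } (representatives vanishing off [0,1]) *)
Definition inH (f : R -> C) : Prop :=
  L2 f /\ (forall x : R, ~ (0 <= x <= 1) -> f x = 0).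

Definition ip (f g : R -> C) : C := cint setT (fun x => f x * cconj (g x)).
Definition l2norm (f : R -> C) : R := Num.sqrt (Rintegral leb setT (fun x => csq (f x))).
Definition l2normJ (J : set R) (g : R -> C) : R :=
  Num.sqrt (fine (\int[leb]_(x in J) (csq (g x))%:E)).

Definition fhat (f : R -> C) (w : R) : C :=
  cint setT (fun x => f x * cexpi (- (2 * pi * w * x))).

Definition findim_subspace_H (T : set (R -> C)) : Prop :=
  exists (n : nat) (b : 'I_n -> R -> C),
    (forall i, inH (b i)) /\
    T = [set f | exists c : 'I_n -> C, f = fun x => \sum_(i < n) c i * b i x].

Definition Omega_set (N : nat) (w : nat -> R) : set R :=
  [set t | exists2 n : nat, (1 <= n <= N)%N & t = w n].

Definition wext (K : R) (N : nat) (w : nat -> R) (n : nat) : R :=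
  if n == 0%N then w N - 2 * K
  else if n == N.+1 then w 1%N + 2 * K
  else w n.

Definition KDdense (K delta : R) (N : nat) (w : nat -> R) : Prop :=
  0 < K /\ 0 < delta < 1 /\
  (0 < N)%N /\
  (forall n m : nat, (1 <= n)%N -> (n < m)%N -> (m <= N)%N -> w n < w m) /\
  (forall n : nat, (1 <= n <= N)%N -> - K <= w n <= K) /\
  (forall n : nat, (n <= N)%N -> wext K N w n.+1 - wext K N w n <= delta).

Definition residual (T : set (R -> C)) (z : R) : R :=
  sup [set e | exists f, T f /\ l2norm f = 1 /\
               e = l2normJ (~` `]- z, z[) (fhat f)].

Definition weight (K : R) (N : nat) (w : nat -> R) (n : nat) : R :=
  (wext K N w n.+1 - wext K N w n.-1) / 2.

Definition Sop (K : R) (N : nat) (w : nat -> R) (f : R -> C) : R -> C :=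
  fun x => if (0 <= x <= 1) then
    \sum_(1 <= n < N.+1) (Complex (weight K N w n) 0 * fhat f (w n)
                          * cexpi (2 * pi * w n * x))
  else 0.

Definition admissible (Om : set R) (T : set (R -> C))
    (S : (R -> C) -> (R -> C)) : Prop :=
  (forall f, inH f -> inH (S f)) /\
  (forall (a : C) f g, inH f -> inH g ->
     S (fun x => a * f x + g x) = (fun x => a * S f x + S g x)) /\
  (exists M : R, forall f, inH f -> l2norm (S f) <= M * l2norm f) /\
  (forall f g, inH f -> inH g ->
     (forall t, Om t -> fhat f t = fhat g t) -> S f = S g) /\
  (forall f g, inH f -> inH g -> ip (S f) g = ip f (S g)) /\
  (forall f g, inH f -> inH g ->
     cabs (ip (S f) g) <= Num.sqrt (complex.Re (ip (S f) f) * complex.Re (ip (S g) g))) /\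
  (exists C1 : R, 0 < C1 /\
     forall f, T f -> C1 * l2norm f ^+ 2 <= complex.Re (ip (S f) f)).

Definition C1const (T : set (R -> C)) (S : (R -> C) -> (R -> C)) : R :=
  sup [set c | forall f, T f -> c * l2norm f ^+ 2 <= complex.Re (ip (S f) f)].

Definition C2const (S : (R -> C) -> (R -> C)) : R :=
  inf [set c | forall f, inH f -> complex.Re (ip (S f) f) <= c * l2norm f ^+ 2].

Definition recon_const (T : set (R -> C)) (S : (R -> C) -> (R -> C)) : R :=
  Num.sqrt (C2const S / C1const T S).

End Defs.

(* Main.v *)
(** With [F] the Fourier transform of [f] in [H], centred so that the support of
    [f] becomes [-1/2, 1/2], Plancherel's theorem gives [||F|| = ||f||] and
    [||F'|| <= pi ||f||]. On the cell of length [mu_n] around the node [w_n],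
    Wirtinger's inequality bounds the distance of [F] to the constant [F w_n] by
    [delta / pi] times the norm of [F'], so that, in L2 of the union of the cells,
    [F] is within [delta ||f||] of a step function whose squared norm is
    [<S f, f> = sum_n mu_n |F w_n|^2]. The triangle inequality yields
    [sqrt <S f, f> <= (1 + delta) ||f||]; since the cells cover
    [(- (K - 1/2), K - 1/2)], it also yields
    [sqrt <S f, f> >= (sqrt (1 - E^2) - delta) ||f||] for [f] in [T].

    Plancherel's theorem on [0, 1] is obtained from Bessel's inequality at the
    frequencies [theta + Z], integrated over [theta]: the defect
    [||f||^2 - ||F||^2] is then a nonnegative quadratic form bounded by
    [||f||^2], so its null vectors form a closed subspace. This subspace contains
    the indicators of intervals, for which the identity reads
    [int sin^2 (c w) / w^2 dw = pi c], and is hence everything. *)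
Require Import Defs.
From HB Require Import structures.
From mathcomp Require Import all_boot all_order all_algebra.
From mathcomp Require Import all_classical all_reals all_analysis.
From mathcomp Require Import complex.
From mathcomp Require Import measurable_realfun.
From mathcomp Require Import ring lra.

Set Implicit Arguments.
Unset Strict Implicit.
Unset Printing Implicit Defensive.

Import Order.TTheory GRing.Theory Num.Theory.
Import numFieldNormedType.Exports.
Local Open Scope classical_set_scope.
Local Open Scope ring_scope.

(** * Square-integrable functions on the unit interval *)

(** The two factors pi cancel: the bound pi ||f|| for the derivative meets Wirtinger's factor delta
    / pi, which leaves exactly delta. Wirtinger's inequality is reached only for constants k < pi /
    delta, because its tangent multiplier blows up at the limit; the sharp constant is recovered by
    letting k tend to pi / delta. The 1/2 in K - 1/2 is what the cells may lose at either end: their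
    union has length 2 K but need not be centred at 0.

    Norms are compared through their squares. The triangle inequality appears as (a + b)^2 <= (1 +
    t) a^2 + (1 + 1/t) b^2 for every t > 0, which integrates over each cell and sums over the cells;
    t is optimised once, at the end. Likewise the null vectors of the defect are stable under
    addition by the parallelogram identity, with no sesquilinear form. Complex functions enter as
    pairs of real functions, so that derivatives, integrals and inequalities all stay real. *)

Section real_integrable.
Context d (T : measurableType d) (R : realType).
Variables (mu : {measure set T -> \bar R}) (D : set T).
Hypothesis mD : measurable D.
Implicit Types f g : T -> R.

Definition rint f := mu.-integrable D (EFin \o f).

Lemma eq_rint f g : (forall x, D x -> f x = g x) -> rint f -> rint g.
Proof.
move=> fg; apply: eq_integrable => // x /set_mem Dx /=.
by rewrite fg.
Qed.

Lemma rintD f g : rint f -> rint g -> rint (fun x => f x + g x).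
Proof. by move=> hf hg; exact: (integrableD mD hf hg). Qed.

Lemma rintZ c f : rint f -> rint (fun x => c * f x).
Proof. by move=> hf; exact: (integrableZl mD c hf). Qed.

Lemma rintN f : rint f -> rint (fun x => - f x).
Proof.
by move=> /(rintZ (-1)); apply: eq_rint => x _; rewrite mulN1r.
Qed.

Lemma rintB f g : rint f -> rint g -> rint (fun x => f x - g x).
Proof. by move=> hf /rintN; exact: rintD. Qed.

Lemma rint_sum I (s : seq I) (F : I -> T -> R) :
  (forall i, rint (F i)) -> rint (fun x => \sum_(i <- s) F i x).
Proof.
move=> hF; elim: s => [|i s IH].
  by apply: (@eq_rint (fun=> 0)); [move=> x _; rewrite big_nil|exact: integrable0].
apply: (@eq_rint (fun x => F i x + \sum_(j <- s) F j x)).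
  by move=> x _; rewrite big_cons.
exact: rintD.
Qed.

Lemma rint_le f g : measurable_fun D f -> (forall x, D x -> `|f x| <= g x) ->
  rint g -> rint f.
Proof.
move=> mf fg; apply: (le_integrable mD) => /=; first exact/measurable_EFinP.
by move=> x Dx; rewrite lee_fin (le_trans (fg _ Dx)) ?ler_norm.
Qed.

Lemma Rintegral_sum I (s : seq I) (F : I -> T -> R) :
  (forall i, rint (F i)) ->
  (\int[mu]_(x in D) (\sum_(i <- s) F i x)) =
  \sum_(i <- s) \int[mu]_(x in D) F i x.
Proof.
move=> hF; elim: s => [|i s IH].
  rewrite big_nil -[RHS](mul0r (fine (mu D))) -Rintegral_cst//.
  by apply: eq_Rintegral => x _; rewrite big_nil.
rewrite big_cons -IH -RintegralD//; [|exact: hF|exact: rint_sum].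
by apply: eq_Rintegral => x _; rewrite big_cons.
Qed.

Lemma EFin_Rintegral f : rint f ->
  (\int[mu]_(x in D) (f x)%:E = (\int[mu]_(x in D) f x)%:E)%E.
Proof. by move=> hf; rewrite /Rintegral fineK//; exact: integrable_fin_num. Qed.

Lemma ge0_rint f : measurable_fun D f -> (forall x, D x -> 0 <= f x) ->
  (\int[mu]_(x in D) (f x)%:E < +oo)%E -> rint f.
Proof.
move=> mf f0 foo; apply/integrableP; split; first exact/measurable_EFinP.
rewrite (eq_integral (fun x => (f x)%:E))//.
by move=> x /set_mem Dx /=; rewrite ger0_norm ?f0.
Qed.

End real_integrable.

(** * The fundamental theorem of calculus on a segment *)

Section ftc_interval.
Context {R : realType}.
Notation mu := (@lebesgue_measure R).
Implicit Types (f F : R -> R) (a b : R).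

Lemma within_is_derive_continuous F f a b :
  (forall x, a <= x <= b -> is_derive x 1 F (f x)) ->
  {within `[a, b], continuous F}.
Proof.
move=> dF; apply: derivable_within_continuous => x.
by rewrite in_itv => /dF/@ex_derive.
Qed.

Lemma rint_continuous f a b : {within `[a, b], continuous f} ->
  rint mu `[a, b] f.
Proof.
by move=> cf; apply: continuous_compact_integrable => //; exact: segment_compact.
Qed.

Lemma Rintegral_is_derive f F a b : a <= b ->
  (forall x, a <= x <= b -> is_derive x 1 F (f x)) ->
  {within `[a, b], continuous f} ->
  \int[mu]_(x in `[a, b]) f x = F b - F a.
Proof.
rewrite le_eqVlt => /predU1P[<- *|ab dF cf].
  by rewrite set_itv1 Rintegral_set1 subrr.
have dcF x : a <= x <= b -> {for x, continuous F}.
  by move=> /dF/@ex_derive/derivable1_diffP/differentiable_continuous.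
rewrite /Rintegral (@continuous_FTC2 _ f F)//.
- split.
  + move=> x; rewrite in_itv/= => /andP[ax xb].
    by apply: (@ex_derive _ _ _ _ _ _ (f x)); apply: dF; rewrite !ltW.
  + by apply: cvg_at_right_filter; apply: dcF; rewrite lexx ltW.
  + by apply: cvg_at_left_filter; apply: dcF; rewrite lexx ltW.
- move=> x; rewrite in_itv/= => /andP[ax xb].
  by rewrite derive1E; apply: @derive_val; apply: dF; rewrite !ltW.
Qed.

End ftc_interval.

(* Functions measurable for the very structure that carries Lebesgue measure,
   which is convertible, but not syntactically equal, to the canonical one. *)
Notation mfunR A f := (@measurable_fun _ _ (measurableTypeR _) _ A f).

Section square_integrable.
Context {R : realType}.
Notation mu := (@lebesgue_measure R).
Notation D := (`[0, 1]%classic : set R).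
Notation int01 f := (Rintegral mu D f).
Implicit Types p q b : R -> R.

Lemma measurable01 : measurable (D : set (measurableTypeR R)). Proof. exact: measurable_itv. Qed.

(** Integrability of [p ^+ 2] does not make [p] measurable, hence the first conjunct. *)
Definition sqint p := mfunR D p /\ rint mu D (fun x => p x ^+ 2).

Lemma eq_sqint p q : (forall x, D x -> p x = q x) -> sqint p -> sqint q.
Proof.
move=> pq [mp ip]; split.
  by apply: eq_measurable_fun mp => x /set_mem /pq.
by apply: (eq_rint measurable01 _ ip) => x Dx; rewrite pq.
Qed.

Lemma rint_mul p q : sqint p -> sqint q -> rint mu D (fun x => p x * q x).
Proof.
move=> [mp ip] [mq iq]; apply: (@rint_le _ _ _ _ _ measurable01 _ (fun x => p x ^+ 2 + q x ^+ 2)) => //.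
- exact: measurable_funM.
- move=> x _; rewrite ler_norml; apply/andP; split; nra.
- exact: rintD.
Qed.

Lemma sqintD p q : sqint p -> sqint q -> sqint (fun x => p x + q x).
Proof.
move=> hp hq; split; first exact: measurable_funD hp.1 hq.1.
apply: (@eq_rint _ _ _ _ _ measurable01 (fun x => (p x ^+ 2 + q x ^+ 2) + 2 * (p x * q x))).
  by move=> x _; ring.
apply: rintD => //; first exact: rintD hp.2 hq.2.
by apply: rintZ => //; exact: rint_mul.
Qed.

Lemma sqintZ c p : sqint p -> sqint (fun x => c * p x).
Proof.
move=> hp; split; first exact: measurable_funM (measurable_cst _) hp.1.
apply: (@eq_rint _ _ _ _ _ measurable01 (fun x => c ^+ 2 * p x ^+ 2)).
  by move=> x _; ring.
by apply: rintZ => //; exact: hp.2.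
Qed.

Lemma sqintN p : sqint p -> sqint (fun x => - p x).
Proof. by move=> /(sqintZ (-1)); apply: eq_sqint => x _; rewrite mulN1r. Qed.

Lemma sqintB p q : sqint p -> sqint q -> sqint (fun x => p x - q x).
Proof. by move=> hp /sqintN; exact: sqintD. Qed.

Lemma sqint_bounded_mul b p M : mfunR D b ->
  (forall x, D x -> `|b x| <= M) -> sqint p -> sqint (fun x => b x * p x).
Proof.
move=> mb bM hp; split; first exact: measurable_funM mb hp.1.
apply: (@rint_le _ _ _ _ _ measurable01 _ (fun x => M ^+ 2 * p x ^+ 2)) => //.
- by apply: measurable_funX; exact: measurable_funM mb hp.1.
- move=> x Dx; rewrite normrX normrM exprMn (real_normK (num_real (p x))).
  rewrite ler_wpM2r ?sqr_ge0// ler_sqr ?nnegrE//; first exact: bM.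
  exact: le_trans (bM x Dx).
- by apply: rintZ => //; exact: hp.2.
Qed.

Lemma rint_cst01 c : rint mu D (fun=> c).
Proof.
apply: rint_continuous => x; exact: cst_continuous.
Qed.

Lemma sqint_cst c : sqint (fun=> c).
Proof. by split => //; exact: rint_cst01. Qed.

Lemma sqint_bounded b M : mfunR D b ->
  (forall x, D x -> `|b x| <= M) -> sqint b.
Proof.
move=> mb bM; apply: (@eq_sqint (fun x => b x * 1)) => [x _|]; first by rewrite mulr1.
exact: sqint_bounded_mul bM (sqint_cst 1).
Qed.

Lemma sqint_rint p : sqint p -> rint mu D p.
Proof.
move=> /rint_mul/(_ (sqint_cst 1)); apply: (eq_rint measurable01) => x _; exact: mulr1.
Qed.

End square_integrable.

(** * The Fourier transform as a pair of real integrals *)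

Section fourier_pairing.
Context {R : realType}.
Notation mu := (@lebesgue_measure R).
Notation D := (`[0, 1]%classic : set R).
Notation int01 f := (Rintegral mu D f).
Implicit Types p q b : R -> R.

(** The phase is measured from a movable centre [s]: Plancherel's theorem is proved at [s = 0], the
    derivative is estimated at [s = 1 / 2]. *)
Definition tc (s w x : R) : R := cos (2 * pi * w * (x - s)).
Definition ts (s w x : R) : R := sin (2 * pi * w * (x - s)).

Lemma tc2ts2 s w x : tc s w x ^+ 2 + ts s w x ^+ 2 = 1.
Proof. exact: cos2Dsin2. Qed.

Lemma continuous_tc s w : continuous (tc s w).
Proof.
move=> x; apply: (@continuous_comp _ _ _ (fun y => 2 * pi * w * (y - s)) cos).
  by apply: cvgM; [exact: cvg_cst|apply: cvgB; [exact: cvg_id|exact: cvg_cst]].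
exact: continuous_cos.
Qed.

Lemma continuous_ts s w : continuous (ts s w).
Proof.
move=> x; apply: (@continuous_comp _ _ _ (fun y => 2 * pi * w * (y - s)) sin).
  by apply: cvgM; [exact: cvg_cst|apply: cvgB; [exact: cvg_id|exact: cvg_cst]].
exact: continuous_sin.
Qed.

Lemma measurable_tc s w (A : set R) : mfunR A (tc s w).
Proof.
apply: measurable_funTS; apply: continuous_measurable_fun; exact: continuous_tc.
Qed.

Lemma measurable_ts s w (A : set R) : mfunR A (ts s w).
Proof.
apply: measurable_funTS; apply: continuous_measurable_fun; exact: continuous_ts.
Qed.

Lemma sqint_tc s w : sqint (tc s w).
Proof. by apply: (@sqint_bounded _ _ 1) => [|x _]; [exact: measurable_tc|exact: cos_max]. Qed.

Lemma sqint_ts s w : sqint (ts s w).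
Proof. by apply: (@sqint_bounded _ _ 1) => [|x _]; [exact: measurable_ts|exact: sin_max]. Qed.

(* With [f = p + i q], [ft s p q w] and [ft s q (- p) w] are the real and
   imaginary parts of [exp (2 i pi w s)] times the Fourier transform of [f]. *)
Definition ft (s : R) p q (w : R) : R :=
  int01 (fun x => p x * tc s w x + q x * ts s w x).

(** The squared modulus of the Fourier transform of [p + i q] at [w], whatever the centre [s]. *)
Definition nft (s : R) p q (w : R) : R :=
  ft s p q w ^+ 2 + ft s q (fun x => - p x) w ^+ 2.

Definition nsq p q : R := int01 (fun x => p x ^+ 2 + q x ^+ 2).

Lemma rint_ft s p q w : sqint p -> sqint q ->
  rint mu D (fun x => p x * tc s w x + q x * ts s w x).
Proof.
by move=> hp hq; apply: rintD => //; apply: rint_mul => //;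
  [exact: sqint_tc|exact: sqint_ts].
Qed.

Lemma rint_nsq p q : sqint p -> sqint q ->
  rint mu D (fun x => p x ^+ 2 + q x ^+ 2).
Proof. by move=> hp hq; apply: rintD => //; [exact: hp.2|exact: hq.2]. Qed.

Lemma eq_ft s p q p' q' w : (forall x, D x -> p x = p' x) ->
  (forall x, D x -> q x = q' x) -> ft s p q w = ft s p' q' w.
Proof.
by move=> pp qq; apply: eq_Rintegral => x /set_mem Dx; rewrite pp ?qq.
Qed.

Lemma eq_nft s p q p' q' w : (forall x, D x -> p x = p' x) ->
  (forall x, D x -> q x = q' x) -> nft s p q w = nft s p' q' w.
Proof.
move=> pp qq; rewrite /nft (eq_ft s w pp qq) (@eq_ft s q _ q' (fun x => - p' x))//.
by move=> x /pp ->.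
Qed.

Lemma eq_nsq p q p' q' : (forall x, D x -> p x = p' x) ->
  (forall x, D x -> q x = q' x) -> nsq p q = nsq p' q'.
Proof.
by move=> pp qq; apply: eq_Rintegral => x /set_mem Dx; rewrite pp ?qq.
Qed.

Lemma nsq_ge0 p q : 0 <= nsq p q.
Proof. by apply: Rintegral_ge0 => x _; rewrite addr_ge0 ?sqr_ge0. Qed.

Lemma nft_ge0 s p q w : 0 <= nft s p q w.
Proof. by rewrite addr_ge0 ?sqr_ge0. Qed.

Lemma ftD s p q p' q' w : sqint p -> sqint q -> sqint p' -> sqint q' ->
  ft s (fun x => p x + p' x) (fun x => q x + q' x) w = ft s p q w + ft s p' q' w.
Proof.
move=> *; rewrite /ft -RintegralD//; try exact: rint_ft.
by apply: eq_Rintegral => x _; ring.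
Qed.

Lemma ftZ s c p q w : sqint p -> sqint q ->
  ft s (fun x => c * p x) (fun x => c * q x) w = c * ft s p q w.
Proof.
move=> *; rewrite /ft -RintegralZl//; try exact: rint_ft.
by apply: eq_Rintegral => x _; ring.
Qed.

Lemma ftN s p q w : sqint p -> sqint q ->
  ft s (fun x => - p x) (fun x => - q x) w = - ft s p q w.
Proof.
move=> *; rewrite -mulN1r -ftZ//.
by apply: eq_ft => x _; rewrite mulN1r.
Qed.

Lemma ft_shift s p q w : sqint p -> sqint q ->
  ft s p q w = cos (2 * pi * w * s) * ft 0 p q w
             - sin (2 * pi * w * s) * ft 0 q (fun x => - p x) w.
Proof.
move=> hp hq.
have hn := sqintN hp.
rewrite /ft -RintegralZl//; last exact: rint_ft.
rewrite -RintegralZl//; last exact: rint_ft.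
rewrite -RintegralB//; [|by apply: rintZ => //; exact: rint_ft..].
apply: eq_Rintegral => x _; rewrite /tc /ts subr0.
by rewrite mulrBr cosB sinB; ring.
Qed.

(** Moving the centre multiplies the transform by the unimodular number [exp (2 i pi w s)], which
    rotates the pair of its real and imaginary parts. *)
Lemma nft_shift s p q w : sqint p -> sqint q -> nft s p q w = nft 0 p q w.
Proof.
move=> hp hq; have hn := sqintN hp; have hnq := sqintN hq.
rewrite /nft (@ft_shift s p q)// (@ft_shift s q)//.
rewrite (@ftN 0 p q)//.
have := cos2Dsin2 (2 * pi * w * s).
set c := cos _; set d := sin _; set A := ft _ _ _ _; set B := ft _ _ _ _.
move=> cd; rewrite -[RHS]mul1r -cd; ring.
Qed.

Let dtc (s x w : R) : is_derive w 1 (fun w => tc s w x) (- (2 * pi * (x - s)) * ts s w x).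
Proof.
rewrite /tc /ts; apply: is_derive_eq => //=.
rewrite /GRing.scale /=; ring.
Qed.

Let dts (s x w : R) : is_derive w 1 (fun w => ts s w x) (2 * pi * (x - s) * tc s w x).
Proof.
rewrite /tc /ts; apply: is_derive_eq => //=.
rewrite /GRing.scale /=; ring.
Qed.

Lemma sqint_dft s c p : sqint p -> sqint (fun x => c * (x - s) * p x).
Proof.
move=> hp; apply: (@sqint_bounded_mul _ _ _ (`|c| * (1 + `|s|))) => //.
  by apply: measurable_funM => //; exact: measurable_funB.
move=> x; rewrite /= in_itv/= => /andP[x0 x1]; rewrite normrM ler_wpM2l//.
by rewrite (le_trans (ler_normB _ _))// ger0_norm// lerD2r.
Qed.

(** Differentiation under the integral sign: the new function is [- 2 i pi (x - s) (p + i q)], split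
    into real and imaginary parts. As sines and cosines are at most 1 in absolute value, the
    dominating function [G] does not depend on the frequency. *)
Lemma is_derive_ft s p q (w : R) : sqint p -> sqint q ->
  is_derive w 1 (ft s p q)
    (ft s (fun x => 2 * pi * (x - s) * q x) (fun x => - (2 * pi) * (x - s) * p x) w).
Proof.
move=> hp hq.
pose f (w x : R) := p x * tc s w x + q x * ts s w x.
have df (w' x : R) : is_derive w' 1 (f ^~ x)
    ((2 * pi * (x - s) * q x) * tc s w' x + (- (2 * pi) * (x - s) * p x) * ts s w' x).
  have := dtc s x w'; have := dts s x w' => ? ?.
  rewrite /f; apply: is_derive_eq; rewrite /GRing.scale/=; ring.
pose G x := `|2 * pi * (x - s) * q x| + `|- (2 * pi) * (x - s) * p x|.
have G0 x : 0 <= G x by rewrite addr_ge0.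
have intG : mu.-integrable D (EFin \o G).
  by apply: rintD => //; apply: integrable_norm; apply: sqint_rint; exact: sqint_dft.
have intf w' : `]w - 1, w + 1[%classic w' -> mu.-integrable D (EFin \o f w').
  by move=> _; exact: rint_ft.
have derf w' x : `]w - 1, w + 1[%classic w' -> D x -> derivable (f ^~ x) w' 1.
  by move=> _ _; have := df w' x => /@ex_derive.
have Gub w' x : `]w - 1, w + 1[%classic w' -> D x -> `|partial1of2 f w' x| <= G x.
  move=> _ _; rewrite partial1of2E; have /@derive_val -> := df w' x.
  rewrite (le_trans (ler_normD _ _))// lerD// normrM ler_piMr//.
    exact: cos_max.
  exact: sin_max.
have Iw : `]w - 1, w + 1[%classic w by rewrite /= in_itv/=; apply/andP; split; lra.
have := derivable_under_integral measurable01 Iw intf derf G0 intG Gub.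
have := differentiation_under_integral measurable01 Iw intf derf G0 intG Gub.
rewrite derive1E => Dval dF.
apply: DeriveDef => //; rewrite Dval.
by apply: eq_Rintegral => x _; rewrite partial1of2E; have /@derive_val -> := df w x.
Qed.

Lemma continuous_ft s p q : sqint p -> sqint q -> continuous (ft s p q).
Proof.
move=> hp hq w; have /@ex_derive := is_derive_ft s w hp hq.
by move=> /derivable1_diffP/differentiable_continuous.
Qed.

Lemma continuous_nft s p q : sqint p -> sqint q -> continuous (nft s p q).
Proof.
move=> hp hq w.
by apply: cvgD; apply: cvgM; apply: continuous_ft => //; exact: sqintN.
Qed.

End fourier_pairing.

(** * Bessel's inequality *)

Section interval_splitting.
Context {R : realType}.
Notation mu := (@lebesgue_measure R).
Implicit Types (h : R -> R) (a b c : R).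

Lemma Rintegral_split h a b c : a <= b -> b <= c ->
  rint mu `[a, c] h ->
  \int[mu]_(x in `[a, c]) h x =
  \int[mu]_(x in `[a, b]) h x + \int[mu]_(x in `[b, c]) h x.
Proof.
move=> ab bc hi.
have := @Rintegral_itvB _ h (BLeft a) (BRight c) b hi.
rewrite !bnd_simp => /(_ ab bc)/eqP; rewrite subr_eq addrC => /eqP ->.
congr (_ + _); rewrite Rintegral_itv_obnd_cbnd//.
apply: integrableS hi => //.
by apply: subset_itvr; rewrite bnd_simp.
Qed.

Lemma Rintegral_translate h a : continuous h ->
  \int[mu]_(x in `[a, a + 1]) h x = \int[mu]_(x in `[0, 1]) h (a + x).
Proof.
move=> ch; pose F x := a + x.
have dF (x : R) : is_derive x 1 F 1.
  rewrite -[X in is_derive _ _ _ X]add0r.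
  exact: (is_deriveD (is_derive_cst a x 1) (is_derive_id x 1)).
have dF1 : derive1 F = fun=> 1.
  by apply/funext => x; rewrite derive1E; have /@derive_val -> := dF x.
have cF : continuous F.
  by move=> x; have /@ex_derive/derivable1_diffP/differentiable_continuous := dF x.
have := @integration_by_substitution_increasing R F h 0 1 ler01.
rewrite (_ : F 0 = a); last by rewrite /F addr0.
move=> H; rewrite /Rintegral -[a + 1]/(F 1) H.
- by congr fine; apply: eq_integral => x _; rewrite /= dF1 [in LHS]/GRing.mul /= mulr1.
- by move=> x y _ _ xy; rewrite /F ltrD2l.
- by move=> x _; rewrite dF1; exact: cst_continuous.
- by rewrite dF1; exact: is_cvg_cst.
- by rewrite dF1; exact: is_cvg_cst.
- split.
  + by move=> x _; have /@ex_derive := dF x.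
  + by apply: cvg_at_right_filter; exact: cF.
  + by apply: cvg_at_left_filter; exact: cF.
- exact: continuous_subspaceT.
Qed.

Lemma Rintegral_unit_cells h a k : continuous h ->
  \int[mu]_(x in `[a, a + k%:R]) h x =
  \sum_(0 <= i < k) \int[mu]_(x in `[0, 1]) h (a + i%:R + x).
Proof.
move=> ch; elim: k => [|k IH].
  by rewrite addr0 set_itv1 Rintegral_set1 big_geq.
rewrite big_nat_recr//= -IH (@Rintegral_split _ _ (a + k%:R)).
- by rewrite -natr1 addrA (Rintegral_translate (a + k%:R)).
- by rewrite lerDl.
- by rewrite lerD2l ler_nat.
- by apply: rint_continuous; exact: continuous_subspaceT.
Qed.

End interval_splitting.

(** * Orthogonality of the exponentials on the unit interval *)

Section bessel.
Context {R : realType}.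
Notation mu := (@lebesgue_measure R).
Notation D := (`[0, 1]%classic : set R).
Notation int01 f := (Rintegral mu D f).
Implicit Types (p q : R -> R) (w : R).

Lemma Rintegral_cst01 (c : R) : int01 (fun=> c) = c.
Proof.
have dF (x : R) : 0 <= x <= 1 -> is_derive x 1 (fun x => c * x) c.
  by move=> _; apply: is_derive_eq; rewrite /GRing.scale/= mulr1.
rewrite (Rintegral_is_derive ler01 dF) ?mulr1 ?mulr0 ?subr0//.
by move=> x; exact: cst_continuous.
Qed.

Lemma pi_neq0 : pi != 0 :> R.
Proof. by rewrite gt_eqF ?pi_gt0. Qed.

Lemma int01_tc w : w != 0 -> sin (2 * pi * w) = 0 -> int01 (tc 0 w) = 0.
Proof.
move=> w0 s0.
have k0 : 2 * pi * w != 0 by rewrite !mulf_eq0 !negb_or pnatr_eq0 pi_neq0 w0.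
have dF (x : R) : 0 <= x <= 1 ->
    is_derive x 1 (fun x => (2 * pi * w)^-1 * ts 0 w x) (tc 0 w x).
  move=> _; rewrite /ts /tc; apply: is_derive_eq.
  rewrite /GRing.scale/=; move: (pi : R) pi_neq0 => P P0.
  by field; rewrite w0 P0.
rewrite (Rintegral_is_derive ler01 dF); last first.
  apply: continuous_subspaceT; exact: continuous_tc.
by rewrite /ts !subr0 mulr0 sin0 mulr1 s0 mulr0 subr0.
Qed.

Lemma int01_ts w : cos (2 * pi * w) = 1 -> int01 (ts 0 w) = 0.
Proof.
move=> c1; have [->|w0] := eqVneq w 0.
  rewrite -[RHS](mul0r (fine (mu D))) -Rintegral_cst//.
  by apply: eq_Rintegral => x _; rewrite /ts mulr0 mul0r sin0.
have k0 : 2 * pi * w != 0 by rewrite !mulf_eq0 !negb_or pnatr_eq0 pi_neq0 w0.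
have dF (x : R) : 0 <= x <= 1 ->
    is_derive x 1 (fun x => - (2 * pi * w)^-1 * tc 0 w x) (ts 0 w x).
  move=> _; rewrite /ts /tc; apply: is_derive_eq.
  rewrite /GRing.scale/=; move: (pi : R) pi_neq0 => P P0.
  by field; rewrite w0 P0.
rewrite (Rintegral_is_derive ler01 dF); last first.
  apply: continuous_subspaceT; exact: continuous_ts.
by rewrite /tc !subr0 mulr0 cos0 mulr1 c1 subrr.
Qed.

Lemma sqint_trig s A B w : sqint (fun x => A * tc s w x - B * ts s w x).
Proof.
by apply: sqintB; apply: sqintZ; [exact: sqint_tc|exact: sqint_ts].
Qed.

Lemma sqint_trig' s A B w : sqint (fun x => A * ts s w x + B * tc s w x).
Proof.
by apply: sqintD; apply: sqintZ; [exact: sqint_ts|exact: sqint_tc].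
Qed.

(** The pair is [(A + i B) exp (2 i pi w x)], so pairing it with the frequency [v] only involves
    [w - v]. *)
Lemma ft_trig A B w v :
  ft 0 (fun x => A * tc 0 w x - B * ts 0 w x)
       (fun x => A * ts 0 w x + B * tc 0 w x) v =
  A * int01 (tc 0 (w - v)) - B * int01 (ts 0 (w - v)).
Proof.
rewrite /ft -RintegralZl//; last exact/sqint_rint/sqint_tc.
rewrite -RintegralZl//; last exact/sqint_rint/sqint_ts.
rewrite -RintegralB//; [|by apply: rintZ => //; exact/sqint_rint/sqint_tc
                       |by apply: rintZ => //; exact/sqint_rint/sqint_ts].
apply: eq_Rintegral => x _; rewrite /tc /ts !subr0.
have -> : 2 * pi * (w - v) * x = 2 * pi * w * x - 2 * pi * v * x by ring.
by rewrite cosB sinB; ring.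
Qed.

(** Pythagoras: [A + i B] is the coefficient of [p + i q] on the unit vector [exp (2 i pi w x)], and
    the subtracted pair is the orthogonal projection on it. *)
Lemma nsq_trigB p q w : sqint p -> sqint q ->
  let A := ft 0 p q w in let B := ft 0 q (fun x => - p x) w in
  nsq (fun x => p x - (A * tc 0 w x - B * ts 0 w x))
      (fun x => q x - (A * ts 0 w x + B * tc 0 w x)) =
  nsq p q - nft 0 p q w.
Proof.
move=> hp hq A B; have hn := sqintN hp.
transitivity (nsq p q + (- 2 * A * ft 0 p q w
    + - 2 * B * ft 0 q (fun x => - p x) w + (A ^+ 2 + B ^+ 2))); last first.
  by rewrite /nft -/A -/B; ring.
have -> : A ^+ 2 + B ^+ 2 = int01 (fun=> A ^+ 2 + B ^+ 2).
  by rewrite Rintegral_cst01.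
have i1 := rintZ measurable01 (- 2 * A) (rint_ft 0 w hp hq).
have i2 := rintZ measurable01 (- 2 * B) (rint_ft 0 w hq hn).
have i3 := rint_cst01 (A ^+ 2 + B ^+ 2).
have i12 := rintD measurable01 i1 i2; have i123 := rintD measurable01 i12 i3.
rewrite /ft /nsq -(RintegralZl _ measurable01 (rint_ft 0 w hp hq)).
rewrite -(RintegralZl _ measurable01 (rint_ft 0 w hq hn)).
rewrite -(RintegralD measurable01 i1 i2) -(RintegralD measurable01 i12 i3).
rewrite -(RintegralD measurable01 (rint_nsq hp hq) i123).
apply: eq_Rintegral => x _.
have := tc2ts2 0 w x; set c := tc _ _ _; set s := ts _ _ _ => cs.
(* Made homogeneous with [c ^+ 2 + s ^+ 2 = 1], the equality of the integrands becomes a polynomial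
   identity. *)
have -> : A ^+ 2 + B ^+ 2 = (A ^+ 2 + B ^+ 2) * (c ^+ 2 + s ^+ 2).
  by rewrite cs mulr1.
ring.
Qed.

(** The trigonometric hypotheses say that [w - v] is an integer; the exponentials at [w] and [v] are
    then orthogonal, so removing the component at [w] leaves the coefficient at [v] unchanged. *)
Lemma ft_trigB p q w v : sqint p -> sqint q -> w - v != 0 ->
  cos (2 * pi * (w - v)) = 1 -> sin (2 * pi * (w - v)) = 0 ->
  forall A B, nft 0 (fun x => p x - (A * tc 0 w x - B * ts 0 w x))
      (fun x => q x - (A * ts 0 w x + B * tc 0 w x)) v = nft 0 p q v.
Proof.
move=> hp hq d0 dc ds A B.
have h1 := sqint_trig 0 A B w; have h2 := sqint_trig' 0 A B w.
have z C E : ft 0 (fun x => C * tc 0 w x - E * ts 0 w x)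
       (fun x => C * ts 0 w x + E * tc 0 w x) v = 0.
  by rewrite ft_trig int01_tc// int01_ts// !mulr0 subrr.
have sub p1 q1 p2 q2 : sqint p1 -> sqint q1 -> sqint p2 -> sqint q2 ->
    ft 0 p2 q2 v = 0 ->
    ft 0 (fun x => p1 x - p2 x) (fun x => q1 x - q2 x) v = ft 0 p1 q1 v.
  move=> h11 h12 h21 h22 e.
  rewrite (ftD 0 v h11 h12 (sqintN h21) (sqintN h22)).
  by rewrite (ftN 0 v h21 h22) e subr0.
rewrite /nft (sub p q)//; congr (_ + _ ^+ 2).
rewrite -(sub q (fun x => - p x) _ _ hq (sqintN hp) h2 (sqintN h1)).
  by apply: eq_ft => // x _; ring.
rewrite -[RHS](z B (- A)).
by apply: eq_ft => x _; ring.
Qed.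

Lemma cos_natpi2 (n : nat) : cos (2 * pi * n%:R : R) = 1.
Proof.
have -> : 2 * pi * n%:R = 0 + pi *+ 2 *+ n :> R.
  by rewrite add0r -[RHS]mulr_natr -[pi *+ 2]mulr_natr [2 * pi]mulrC.
by rewrite (periodicn (@cosD2pi R)) cos0.
Qed.

Lemma sin_natpi2 (n : nat) : sin (2 * pi * n%:R : R) = 0.
Proof.
have -> : 2 * pi * n%:R = 0 + pi *+ 2 *+ n :> R.
  by rewrite add0r -[RHS]mulr_natr -[pi *+ 2]mulr_natr [2 * pi]mulrC.
by rewrite (periodicn (@sinD2pi R)) sin0.
Qed.

Lemma cos_diffpi2 (i j : nat) : cos (2 * pi * (i%:R - j%:R) : R) = 1.
Proof. by rewrite mulrBr cosB !cos_natpi2 !sin_natpi2 !mulr1 mulr0 addr0. Qed.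

Lemma sin_diffpi2 (i j : nat) : sin (2 * pi * (i%:R - j%:R) : R) = 0.
Proof. by rewrite mulrBr sinB !cos_natpi2 !sin_natpi2 mulr0 mul0r subrr. Qed.

(** Induction on the list of frequencies: removing the component at the head lowers the squared norm
    by exactly its term and keeps the coefficients at the remaining, distinct frequencies. *)
Lemma bessel (a : R) (s : seq nat) p q : uniq s -> sqint p -> sqint q ->
  \sum_(i <- s) nft 0 p q (a + i%:R) <= nsq p q.
Proof.
elim: s p q => [|i s IH] p q; first by rewrite big_nil nsq_ge0.
move=> /= /andP[ins us] hp hq; rewrite big_cons.
set w := a + i%:R.
pose A := ft 0 p q w; pose B := ft 0 q (fun x => - p x) w.
have h1 := sqintB hp (sqint_trig 0 A B w).
have h2 := sqintB hq (sqint_trig' 0 A B w).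
have := IH _ _ us h1 h2.
rewrite nsq_trigB// lerBrDl; apply: le_trans; rewrite lerD2l.
rewrite le_eqVlt; apply/orP; left; apply/eqP; rewrite big_seq [RHS]big_seq.
apply: eq_bigr => j js; apply/esym.
have E : w - (a + j%:R) = i%:R - j%:R by rewrite /w; ring.
apply: ft_trigB; rewrite ?E ?cos_diffpi2 ?sin_diffpi2//.
by rewrite subr_eq0 eqr_nat; apply: contraNneq ins => ->.
Qed.

Lemma measurable_nft s p q : sqint p -> sqint q -> mfunR setT (nft s p q).
Proof. by move=> hp hq; apply: continuous_measurable_fun; exact: continuous_nft. Qed.

(** [[- n, n]] is cut into [2 n] unit cells, all translated to the unit interval. For each [x]
    there, the sum over the cells is a Bessel sum with base frequency [- n + x], hence at most
    [nsq p q]; monotone convergence lets [n] grow. *)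
Lemma integral_nft_le p q : sqint p -> sqint q ->
  (\int[mu]_w (nft 0 p q w)%:E <= (nsq p q)%:E)%E.
Proof.
move=> hp hq.
have ch := @continuous_nft R 0 p q hp hq.
pose F (n : nat) : set (measurableTypeR R) := `[- n%:R, n%:R]%classic.
have FT : \bigcup_n F n = setT by exact: (bigcup_itvT true false).
have mF n : measurable (F n : set (measurableTypeR R)) by exact: measurable_itv.
have ndF : nondecreasing_seq F.
  move=> m n mn; rewrite subsetEset; apply: subset_itv; rewrite bnd_simp.
    by rewrite lerN2 ler_nat.
  by rewrite ler_nat.
have mh n : measurable_fun (F n : set (measurableTypeR R)) (EFin \o nft 0 p q).
  by apply/measurable_EFinP; apply: measurable_funTS; exact: measurable_nft.
have := @ge0_nondecreasing_set_cvg_integral _ (measurableTypeR R) _ F (EFin \o nft 0 p q) mu ndF mF mh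
  (fun i x _ => nft_ge0 0 p q x).
rewrite FT => cv; apply: (cvge_le _ cv); apply: nearW => n.
rewrite [leLHS](@EFin_Rintegral _ _ _ mu (F n) (mF n) (nft 0 p q)); last first.
  by apply: rint_continuous; exact: continuous_subspaceT.
rewrite lee_fin.
have -> : F n = `[- n%:R, - n%:R + n.*2%:R]%classic.
  by rewrite /F; congr [set` Interval _ (BRight _)]; rewrite -addnn natrD addKr.
rewrite Rintegral_unit_cells// -Rintegral_sum//; last first.
  move=> i; apply: rint_continuous; apply: continuous_subspaceT => x.
  apply: continuous_comp; last exact: ch.
  by apply: cvgD; [exact: cvg_cst|exact: cvg_id].
have -> : nsq p q = int01 (fun=> nsq p q).
  by rewrite Rintegral_cst01.
apply: le_Rintegral => //.
- apply: rint_sum => // i.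
  apply: rint_continuous; apply: continuous_subspaceT => x.
  apply: continuous_comp; last exact: ch.
  by apply: cvgD; [exact: cvg_cst|exact: cvg_id].
- exact: rint_cst01.
- move=> x _; under eq_bigr do rewrite addrAC.
  by apply: bessel => //; exact: iota_uniq.
Qed.

Lemma rint_nft p q : sqint p -> sqint q -> rint mu setT (nft 0 p q).
Proof.
move=> hp hq; apply: ge0_rint => //.
- exact: measurable_nft.
- by move=> x _; exact: nft_ge0.
- by rewrite (le_lt_trans (integral_nft_le hp hq)) ?ltry.
Qed.

Lemma Rintegral_nft_le p q : sqint p -> sqint q ->
  \int[mu]_w nft 0 p q w <= nsq p q.
Proof.
move=> hp hq; rewrite -lee_fin -EFin_Rintegral//; last exact: rint_nft.
exact: integral_nft_le.
Qed.

End bessel.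

(** * The integral of the squared sine kernel *)

Section sine_kernel.
Context {R : realType}.
Notation mu := (@lebesgue_measure R).
Notation P := (`]0, +oo[%classic : set R).
Implicit Types (f F : R -> R).

Lemma derivable_continuous_at f (x : R) :
  derivable f x (1 : R) -> {for x, continuous f}.
Proof. by move=> /derivable1_diffP/differentiable_continuous. Qed.

Lemma integral_is_derive_itvoy f F (l : R) : (forall x, 0 <= x -> 0 <= f x) ->
  continuous f -> (forall x, is_derive x (1 : R) F (f x)) ->
  F x @[x --> +oo] --> l ->
  (\int[mu]_(x in P) (f x)%:E = (l - F 0)%:E)%E.
Proof.
move=> f0 cf dF Fl.
have mf : mfunR P (EFin \o f).
  by apply/measurable_EFinP; apply: measurable_funTS; exact: continuous_measurable_fun.
rewrite integral_itv_obnd_cbnd// (@ge0_continuous_FTC2y _ f F 0 l)//.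
- exact: continuous_subspaceT.
- apply: cvg_at_right_filter.
  by have /@ex_derive/derivable1_diffP/differentiable_continuous := dF 0.
- by move=> x _; rewrite derive1E; have /@derive_val -> := dF x.
Qed.

Lemma cvgr_expRM (k : R) : 0 < k -> expR (- (k * x)) @[x --> +oo] --> (0 : R).
Proof.
move=> k0; apply: (cvg_comp (fun x => k * x) (fun x => expR (- x))).
  exact: gt0_cvgMry.
exact: cvgr_expR.
Qed.

Lemma cvg0_bounded_expR (f : R -> R) (M k : R) : 0 < k ->
  (forall x, 0 <= x -> `|f x| <= M * expR (- (k * x))) ->
  f x @[x --> +oo] --> (0 : R).
Proof.
move=> k0 fM; apply/norm_cvg0P.
have cM : M * expR (- (k * x)) @[x --> +oo] --> (0 : R).
  by rewrite -(mulr0 M); apply: cvgM; [exact: cvg_cst|exact: cvgr_expRM].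
apply: (squeeze_cvgr _ (cvg_cst 0) cM).
near=> x; rewrite normr_ge0/=; apply: fM.
by near: x; apply: nbhs_pinfty_ge; rewrite num_real.
Unshelve. all: by end_near. Qed.

Lemma integral_texpR (w : R) : 0 < w ->
  (\int[mu]_(t in P) (t * expR (- (w * t)))%:E = ((w ^+ 2)^-1)%:E)%E.
Proof.
move=> w0.
pose F t := - (t / w + (w ^+ 2)^-1) * expR (- (w * t)).
have dF (x : R) : is_derive x (1 : R) F (x * expR (- (w * x))).
  rewrite /F; apply: is_derive_eq.
  rewrite /GRing.scale/=; field; exact: lt0r_neq0.
rewrite (@integral_is_derive_itvoy _ F 0)//.
- by rewrite /F mul0r mulr0 oppr0 expR0 add0r mulr1 opprK add0r.
- by move=> x x0; rewrite mulr_ge0 ?expR_ge0.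
- by move=> x; apply: derivable_continuous_at; exact: ex_derive.
(* Half of the exponential absorbs the linear factor: [expR (w * x / 2) >= 1 + w * x / 2] gives
   [w * x + 1 <= 3 * expR (w * x / 2)]. *)
- apply: (@cvg0_bounded_expR _ (3 / w ^+ 2) (w / 2)); first by rewrite divr_gt0.
  move=> x x0; have wx : 0 <= w * x by rewrite mulr_ge0// ltW.
  have w20 : 0 < w ^+ 2 by rewrite exprn_gt0.
  rewrite normrM normrN !ger0_norm ?expR_ge0//; last first.
    by rewrite addr_ge0 ?divr_ge0// ltW// invr_gt0.
  have -> : expR (- (w * x)) = expR (- (w / 2 * x)) * expR (- (w / 2 * x)).
    by rewrite -expRD; congr expR; field.
  rewrite mulrA ler_wpM2r ?expR_ge0//.
  rewrite expRN ler_pdivrMr ?expR_gt0//.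
  rewrite (_ : x / w + _ = (w * x + 1) / w ^+ 2); last first.
    by field; exact: lt0r_neq0.
  rewrite [leRHS]mulrAC ler_wpM2r ?invr_ge0 ?(ltW w20)//.
  have := expR_ge1Dx (w / 2 * x); lra.
Qed.

(** The Laplace transform of [(1 - cos (2 c w)) / 2], namely half of
    [1 / t - t / (t ^+ 2 + 4 c ^+ 2)]. In the primitive, the double angles are expanded in
    [sin (c w)] and [cos (c w)]. *)
Lemma integral_sin2expR (c t : R) : 0 < t ->
  (\int[mu]_(w in P) (sin (c * w) ^+ 2 * expR (- (w * t)))%:E =
   (2 * c ^+ 2 / (t * (t ^+ 2 + 4 * c ^+ 2)))%:E)%E.
Proof.
move=> t0.
have k0 : 0 < t ^+ 2 + 4 * c ^+ 2.
  by rewrite ltr_wpDr ?exprn_gt0// mulr_ge0// sqr_ge0.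
pose G w := - (2 * t)^-1 + (t * (cos (c * w) ^+ 2 - sin (c * w) ^+ 2)
  - 4 * c * sin (c * w) * cos (c * w)) / (2 * (t ^+ 2 + 4 * c ^+ 2)).
pose F w := expR (- (w * t)) * G w.
have dF (x : R) : is_derive x (1 : R) F (sin (c * x) ^+ 2 * expR (- (x * t))).
  rewrite /F /G; apply: is_derive_eq.
  transitivity (expR (- (x * t)) *
      (2^-1 - (cos (c * x) ^+ 2 - sin (c * x) ^+ 2) / 2)); last first.
    by rewrite cos2sin2; field.
  by rewrite /GRing.scale/=; field; rewrite !lt0r_neq0.
rewrite (@integral_is_derive_itvoy _ F 0)//.
- rewrite /F /G mul0r mulr0 oppr0 expR0 sin0 cos0; congr EFin.
  by field; rewrite !lt0r_neq0.
- by move=> x x0; rewrite mulr_ge0 ?expR_ge0// sqr_ge0.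
- by move=> x; apply: derivable_continuous_at; exact: ex_derive.
- pose M := (2 * t)^-1 + (t * 2 + 4 * `|c|) / (2 * (t ^+ 2 + 4 * c ^+ 2)).
  apply: (@cvg0_bounded_expR _ M t) => // x x0.
  rewrite /F normrM ger0_norm ?expR_ge0// mulrC [t * x]mulrC ler_wpM2r ?expR_ge0//.
  rewrite (le_trans (ler_normD _ _))// normrN ger0_norm ?invr_ge0 ?mulr_ge0 ?(ltW t0)//.
  rewrite lerD2l normrM [X in _ * X <= _]ger0_norm; last first.
    by rewrite invr_ge0 mulr_ge0// ltW.
  rewrite ler_wpM2r//; first by rewrite invr_ge0 mulr_ge0// ltW.
  rewrite (le_trans (ler_normB _ _))// lerD//.
    rewrite normrM ger0_norm ?(ltW t0)// ler_wpM2l ?(ltW t0)//.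
    have := cos2Dsin2 (c * x); have := sqr_ge0 (cos (c * x)); have := sqr_ge0 (sin (c * x)).
    by move=> *; rewrite ler_norml; apply/andP; split; lra.
  rewrite !normrM normr_nat -mulrA ler_piMr ?mulr_ge0//.
  by rewrite mulr_ile1 ?sin_max ?cos_max.
Qed.

Lemma integral_lorentz (c : R) : 0 < c ->
  (\int[mu]_(t in P) (2 * c ^+ 2 / (t ^+ 2 + 4 * c ^+ 2))%:E =
   (pi * c / 2)%:E)%E.
Proof.
move=> c0.
pose F t := c * atan (t / (2 * c)).
have k0 (x : R) : 0 < x ^+ 2 + 4 * c ^+ 2.
  by rewrite ltr_wpDl ?sqr_ge0// mulr_gt0// exprn_gt0.
have dF (x : R) : is_derive x (1 : R) F (2 * c ^+ 2 / (x ^+ 2 + 4 * c ^+ 2)).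
  rewrite /F; apply: is_derive_eq.
  rewrite /GRing.scale/=; field.
  by rewrite ?(lt0r_neq0 (k0 x)) ?(lt0r_neq0 c0) //=.
rewrite (@integral_is_derive_itvoy _ F (c * (pi / 2)))//.
- by rewrite /F mul0r atan0 mulr0 subr0; congr EFin; ring.
- by move=> x _; rewrite divr_ge0// ?mulr_ge0// ?sqr_ge0// ltW.
- move=> x; apply: cvgM; first exact: cvg_cst.
  apply: cvgV; first exact: lt0r_neq0.
  by apply: cvgD; [exact: exprn_continuous|exact: cvg_cst].
- apply: cvgM; first exact: cvg_cst.
  apply: (cvg_comp (fun x => x / (2 * c)) (@atan R)).
    by apply: gt0_cvgMly => //; rewrite invr_gt0 mulr_gt0.
  exact: cvgy_atan.
Qed.

Lemma integral_indicM (k : R -> R) :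
  (\int[mu]_x (\1_P x * k x)%:E = \int[mu]_(x in P) (k x)%:E)%E.
Proof.
rewrite [RHS]integral_mkcond; apply: eq_integral => x _.
by rewrite patchE indicE; case: ifP => _; rewrite ?mul1r ?mul0r.
Qed.

Lemma integral_itvoyZl (a : R) (k : R -> R) : 0 <= a -> mfunR P k ->
  (forall x, P x -> 0 <= k x) ->
  (\int[mu]_(x in P) (a * k x)%:E = a%:E * \int[mu]_(x in P) (k x)%:E)%E.
Proof.
move=> a0 mk k0; by rewrite -ge0_integralZl//; exact/measurable_EFinP.
Qed.

(** [sin (c w) ^+ 2] times the Laplace kernel [t * expR (- (w * t))] on the positive quadrant,
    extended by 0 so that both iterated integrals run over the whole line. *)
Let tonelli_fun (c : R) (z : measurableTypeR R * measurableTypeR R) : R :=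
  \1_P z.1 * (\1_P z.2 * (sin (c * z.1) ^+ 2 * (z.2 * expR (- (z.1 * z.2))))).

Let measurable_tonelli_fun c : measurable_fun setT (tonelli_fun c).
Proof.
pose RR := (measurableTypeR R * measurableTypeR R)%type.
have comp (g : R -> R) (h : RR -> R) : mfunR setT g ->
    @measurable_fun _ _ RR R setT h -> @measurable_fun _ _ RR R setT (fun z => g (h z)).
  by move=> mg mh; exact: (@measurableT_comp _ _ _ RR (measurableTypeR R) R g setT h mg mh).
have m1 : @measurable_fun _ _ RR R setT (fun z => z.1).
  exact: (@measurable_fst _ _ (measurableTypeR R) (measurableTypeR R)).
have m2 : @measurable_fun _ _ RR R setT (fun z => z.2).
  exact: (@measurable_snd _ _ (measurableTypeR R) (measurableTypeR R)).
have mP : measurable (P : set (measurableTypeR R)) by exact: measurable_itv.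
apply: measurable_funM; first exact: comp (measurable_indic mP) m1.
apply: measurable_funM; first exact: comp (measurable_indic mP) m2.
apply: measurable_funM.
  apply: measurable_funX; apply: (comp sin).
    by apply: continuous_measurable_fun; exact: continuous_sin.
  exact: measurable_funM (measurable_cst _) m1.
apply: measurable_funM => //.
apply: (comp (fun x => expR (- x)) (fun z => z.1 * z.2)).
  apply: continuous_measurable_fun => x.
  by apply: derivable_continuous_at; exact: ex_derive.
exact: measurable_funM m1 m2.
Qed.

Let tonelli_inner_w (c t : R) :
  (\int[mu]_w (tonelli_fun c (w, t))%:E =
   (\1_P t * (2 * c ^+ 2 / (t ^+ 2 + 4 * c ^+ 2)))%:E)%E.
Proof.
rewrite /tonelli_fun/= [\1_P t]indicE.
case: (boolP (t \in P)) => [tP|_] /=; last first.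
  by rewrite mulr0n mul0r; apply: integral0_eq => w _; rewrite mul0r mulr0.
have t0 : 0 < t by move: tP; rewrite inE/= in_itv/= andbT.
rewrite mulr1n mul1r.
transitivity (\int[mu]_w (\1_P w * (t * (sin (c * w) ^+ 2 * expR (- (w * t)))))%:E)%E.
  by apply: eq_integral => w _; congr EFin; rewrite mul1r [X in _ * X = _]mulrCA.
rewrite integral_indicM integral_itvoyZl ?(ltW t0)//; last 2 first.
- apply: measurable_funTS; apply: continuous_measurable_fun => x.
  by apply: derivable_continuous_at; exact: ex_derive.
- by move=> x _; rewrite mulr_ge0 ?sqr_ge0 ?expR_ge0.
rewrite integral_sin2expR// -EFinM; congr EFin.
have k0 : 0 < t ^+ 2 + 4 * c ^+ 2.
  by rewrite ltr_wpDr ?exprn_gt0// mulr_ge0// sqr_ge0.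
by field; rewrite !lt0r_neq0.
Qed.

Let tonelli_inner_t (c w : R) :
  (\int[mu]_t (tonelli_fun c (w, t))%:E =
   (\1_P w * (sin (c * w) ^+ 2 / w ^+ 2))%:E)%E.
Proof.
rewrite /tonelli_fun/= [\1_P w]indicE.
case: (boolP (w \in P)) => [wP|_] /=; last first.
  by rewrite mulr0n mul0r; apply: integral0_eq => t _; rewrite mul0r.
have w0 : 0 < w by move: wP; rewrite inE/= in_itv/= andbT.
rewrite mulr1n mul1r.
transitivity (\int[mu]_t (\1_P t * (sin (c * w) ^+ 2 * (t * expR (- (w * t)))))%:E)%E.
  by apply: eq_integral => t _; congr EFin; rewrite mul1r.
rewrite integral_indicM integral_itvoyZl ?sqr_ge0//; last 2 first.
- apply: measurable_funTS; apply: continuous_measurable_fun => x.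
  by apply: derivable_continuous_at; exact: ex_derive.
- by move=> x; rewrite /= in_itv/= andbT => x0; rewrite mulr_ge0 ?expR_ge0// ltW.
by rewrite integral_texpR// -EFinM.
Qed.

(* [1 / w ^+ 2] is the Laplace transform of [t] at [w]: Tonelli's theorem trades
   the integral of [sin (c w) ^+ 2 / w ^+ 2] for that of a Lorentzian. *)
Lemma integral_sin2_div (c : R) : 0 < c ->
  (\int[mu]_(w in P) (sin (c * w) ^+ 2 / w ^+ 2)%:E = (pi * c / 2)%:E)%E.
Proof.
move=> c0.
rewrite -integral_indicM -[RHS](integral_lorentz c0) -integral_indicM.
have f0 z : (0 <= (tonelli_fun c z)%:E)%E.
  rewrite /tonelli_fun lee_fin !indicE.
  case: (boolP (z.1 \in P)) => [_|]; last by rewrite mul0r.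
  case: (boolP (z.2 \in P)) => [|_]; last by rewrite mul0r mulr0.
  rewrite !mul1r inE/= in_itv/= andbT => z0.
  by rewrite mulr_ge0 ?sqr_ge0// mulr_ge0 ?expR_ge0// ltW.
have mf : measurable_fun setT (EFin \o tonelli_fun c).
  by apply/measurable_EFinP; exact: measurable_tonelli_fun.
have := @fubini_tonelli _ _ (measurableTypeR R) (measurableTypeR R) R mu mu
  (EFin \o tonelli_fun c) mf f0.
move=> FT; apply: (etrans (etrans _ FT)).
  apply: eq_integral => w _; exact/esym/tonelli_inner_t.
apply: eq_integral => t _; exact: tonelli_inner_w.
Qed.

End sine_kernel.

(** * Plancherel's theorem *)

Section plancherel.
Context {R : realType}.
Notation mu := (@lebesgue_measure R).
Notation D := (`[0, 1]%classic : set R).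
Notation int01 f := (Rintegral mu D f).
Implicit Types (p q u : R -> R) (w : R) (A : set R).

Definition defect p q : R := nsq p q - \int[mu]_w nft 0 p q w.

Lemma defect_ge0 p q : sqint p -> sqint q -> 0 <= defect p q.
Proof. by move=> hp hq; rewrite subr_ge0 Rintegral_nft_le. Qed.

Lemma defect_le p q : defect p q <= nsq p q.
Proof.
by rewrite lerBlDr lerDl; apply: Rintegral_ge0 => w _; exact: nft_ge0.
Qed.

Lemma eq_defect p q p' q' : (forall x, D x -> p x = p' x) ->
  (forall x, D x -> q x = q' x) -> defect p q = defect p' q'.
Proof.
move=> pp qq; refine (congr2 (fun x y => x - y) (eq_nsq pp qq) _).
by apply: eq_Rintegral => w _; exact: eq_nft.
Qed.

Lemma ftB s p q p' q' w : sqint p -> sqint q -> sqint p' -> sqint q' ->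
  ft s (fun x => p x - p' x) (fun x => q x - q' x) w = ft s p q w - ft s p' q' w.
Proof.
move=> hp hq hp' hq'.
by rewrite (ftD s w hp hq (sqintN hp') (sqintN hq')) ftN.
Qed.

Lemma nft_parallelogram s p q p' q' w :
  sqint p -> sqint q -> sqint p' -> sqint q' ->
  nft s (fun x => p x + p' x) (fun x => q x + q' x) w +
  nft s (fun x => p x - p' x) (fun x => q x - q' x) w =
  2 * nft s p q w + 2 * nft s p' q' w.
Proof.
move=> hp hq hp' hq'; have hn := sqintN hp; have hn' := sqintN hp'.
rewrite /nft (ftD s w hp hq hp' hq') (ftB s w hp hq hp' hq').
rewrite (_ : ft s (fun x => q x + q' x) _ w =
  ft s q (fun x => - p x) w + ft s q' (fun x => - p' x) w); last first.
  by rewrite -ftD//; apply: eq_ft => // x _; rewrite opprD.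
rewrite (_ : ft s (fun x => q x - q' x) _ w =
  ft s q (fun x => - p x) w - ft s q' (fun x => - p' x) w); last first.
  by rewrite -ftB//; apply: eq_ft => // x _; ring.
by ring.
Qed.

Lemma nsq_parallelogram p q p' q' :
  sqint p -> sqint q -> sqint p' -> sqint q' ->
  nsq (fun x => p x + p' x) (fun x => q x + q' x) +
  nsq (fun x => p x - p' x) (fun x => q x - q' x) = 2 * nsq p q + 2 * nsq p' q'.
Proof.
move=> hp hq hp' hq'.
have i1 := rint_nsq hp hq; have i2 := rint_nsq hp' hq'.
have e1 := RintegralZl 2 measurable01 i1; have e2 := RintegralZl 2 measurable01 i2.
have e3 := RintegralD measurable01 (rintZ measurable01 2 i1) (rintZ measurable01 2 i2).
have e4 := RintegralD measurable01 (rint_nsq (sqintD hp hp') (sqintD hq hq'))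
  (rint_nsq (sqintB hp hp') (sqintB hq hq')).
refine (etrans (esym e4) (etrans _ (etrans e3 (congr2 _ e1 e2)))).
by apply: eq_Rintegral => x _; ring.
Qed.

Lemma Rintegral_nft_parallelogram p q p' q' :
  sqint p -> sqint q -> sqint p' -> sqint q' ->
  \int[mu]_w nft 0 (fun x => p x + p' x) (fun x => q x + q' x) w +
  \int[mu]_w nft 0 (fun x => p x - p' x) (fun x => q x - q' x) w =
  2 * (\int[mu]_w nft 0 p q w) + 2 * \int[mu]_w nft 0 p' q' w.
Proof.
move=> hp hq hp' hq'.
have i1 := rint_nft hp hq; have i2 := rint_nft hp' hq'.
have e1 := RintegralZl 2 measurableT i1; have e2 := RintegralZl 2 measurableT i2.
have e3 := RintegralD measurableT (rintZ measurableT 2 i1) (rintZ measurableT 2 i2).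
have e4 := RintegralD measurableT (rint_nft (sqintD hp hp') (sqintD hq hq'))
  (rint_nft (sqintB hp hp') (sqintB hq hq')).
refine (etrans (esym e4) (etrans _ (etrans e3 (congr2 _ e1 e2)))).
by apply: eq_Rintegral => x _; exact: nft_parallelogram.
Qed.

(** By the parallelogram identity, the right side is the left side plus the defect of the
    difference, which is nonnegative by Bessel's inequality. *)
Lemma defectD_le p q p' q' : sqint p -> sqint q -> sqint p' -> sqint q' ->
  defect (fun x => p x + p' x) (fun x => q x + q' x) <=
  2 * defect p q + 2 * defect p' q'.
Proof.
move=> hp hq hp' hq'.
have arith (n1 n2 n3 n4 q1 q2 q3 q4 : R) : q1 + q2 = 2 * q3 + 2 * q4 ->
    n1 + n2 = 2 * n3 + 2 * n4 -> 0 <= n2 - q2 ->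
    n1 - q1 <= 2 * (n3 - q3) + 2 * (n4 - q4) by lra.
exact: (arith _ _ _ _ _ _ _ _ (Rintegral_nft_parallelogram hp hq hp' hq')
  (nsq_parallelogram hp hq hp' hq') (defect_ge0 (sqintB hp hp') (sqintB hq hq'))).
Qed.

Lemma defectZ c p q : sqint p -> sqint q ->
  defect (fun x => c * p x) (fun x => c * q x) = c ^+ 2 * defect p q.
Proof.
move=> hp hq.
have e1 := RintegralZl (c ^+ 2) measurable01 (rint_nsq hp hq).
have e2 := RintegralZl (c ^+ 2) measurableT (rint_nft hp hq).
refine (etrans (congr2 (fun x y => x - y) (etrans _ e1) (etrans _ e2)) (esym (mulrBr _ _ _))).
  by apply: eq_Rintegral => x _; ring.
apply: eq_Rintegral => w _; rewrite /nft (ftZ 0 c w hp hq).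
rewrite (_ : ft 0 (fun x => c * q x) _ w = c * ft 0 q (fun x => - p x) w).
  by ring.
by rewrite -ftZ//; [apply: eq_ft => // x _; ring|exact: sqintN].
Qed.

(** Real functions suffice: the defect of [p + i q] is controlled by those of [p] and [i q] through
    [defectD_le]. *)
Definition null u := sqint u /\ defect u (fun=> 0) = 0.

Lemma eq_null u v : (forall x, D x -> u x = v x) -> null u -> null v.
Proof.
move=> uv [hu du]; split; first exact: eq_sqint uv hu.
by rewrite -(eq_defect uv (fun _ _ => erefl)).
Qed.

Lemma nullZ c u : null u -> null (fun x => c * u x).
Proof.
move=> [hu du]; split; first exact: sqintZ.
have e : defect (fun x => c * u x) (fun=> 0) = defect (fun x => c * u x) (fun x => c * 0).
  by apply: eq_defect => // x _; rewrite mulr0.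
by rewrite e (defectZ c hu (sqint_cst 0)) du mulr0.
Qed.

Lemma nullD u v : null u -> null v -> null (fun x => u x + v x).
Proof.
move=> [hu du] [hv dv]; split; first exact: sqintD.
have s0 := @sqint_cst R 0.
have e : defect (fun x => u x + v x) (fun=> 0) =
    defect (fun x => u x + v x) (fun=> 0 + 0).
  by apply: eq_defect => // x _; rewrite addr0.
have := defectD_le hu s0 hv s0; rewrite -e du dv mulr0 addr0 => le0.
by apply: le_anti; apply/andP; split; [exact: le0|exact: defect_ge0 (sqintD hu hv) s0].
Qed.

Lemma null0 : null (fun=> 0).
Proof.
split; first exact: sqint_cst.
have s0 := @sqint_cst R 0.
have e : nsq (fun=> 0 : R) (fun=> 0) = 0.
  by rewrite -[RHS](@Rintegral_cst01 R); apply: eq_Rintegral => x _; ring.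
apply: le_anti; apply/andP; split; last exact: defect_ge0.
by have := defect_le (fun=> 0) (fun=> 0); rewrite e.
Qed.

Lemma null_sum I (s : seq I) (F : I -> R -> R) :
  (forall i, null (F i)) -> null (fun x => \sum_(i <- s) F i x).
Proof.
move=> hF; elim: s => [|i s IH].
  by apply: eq_null null0 => x _; rewrite big_nil.
by apply: eq_null (nullD (hF i) IH) => x _; rewrite big_cons.
Qed.

(** Writing [u = v n + (u - v n)], the defect of [u] is at most twice that of [u - v n], hence at
    most twice its squared norm, which tends to 0 by dominated convergence. *)
Lemma null_dominated (v : nat -> R -> R) u : (forall n, null (v n)) -> sqint u ->
  (forall n x, D x -> `|v n x| <= `|u x|) ->
  (forall x, D x -> v n x @[n --> \oo] --> u x) -> null u.
Proof.
move=> nv hu vu cv; split => //.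
have s0 := @sqint_cst R 0.
apply: le_anti; rewrite (defect_ge0 hu s0) andbT.
have hd n : sqint (fun x => u x - v n x) by apply: sqintB => //; exact: (nv n).1.
have le n : defect u (fun=> 0) <= 2 * int01 (fun x => (u x - v n x) ^+ 2).
  have e : defect u (fun=> 0) = defect (fun x => v n x + (u x - v n x)) (fun=> 0 + 0).
    by apply: eq_defect => x _; rewrite ?addr0//; ring.
  have e' : nsq (fun x => u x - v n x) (fun=> 0) = int01 (fun x => (u x - v n x) ^+ 2).
    by apply: eq_Rintegral => x _; ring.
  have := defectD_le (nv n).1 s0 (hd n) s0; rewrite -e (nv n).2 mulr0 add0r.
  move=> dl; apply: (le_trans dl); rewrite -e'.
  exact: (ler_wpM2l (ler0n _ 2) (defect_le _ _)).
(* From [|v n x| <= |u x|] follows [|u x - v n x| <= 2 |u x|]. *)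
pose g x := 4 * u x ^+ 2.
have ig : rint mu D g by apply: rintZ => //; exact: hu.2.
have [|||||_ _] := @dominated_convergence _ (measurableTypeR R) R mu D measurable01
  (fun n x => ((u x - v n x) ^+ 2)%:E) (fun=> 0%E) (EFin \o g).
- move=> n; exact: measurable_int (hd n).2.
- exact: measurable_cst.
- apply: aeW => x Dx; apply: cvg_EFin; first exact: nearW.
  rewrite -[X in _ --> X](_ : (u x - u x) ^+ 2 = 0 :> R); last by rewrite subrr expr0n.
  rewrite expr2; under eq_fun do rewrite expr2.
  have : (u x - v n x) @[n --> \oo] --> (u x - u x).
    by apply: cvgB; [exact: cvg_cst|exact: cv].
  by move=> c; apply: cvgM.
- exact: ig.
- apply: aeW => x n Dx; rewrite lee_fin ger0_norm ?sqr_ge0//.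
  have := vu n x Dx.
  have -> : g x = (2 * `|u x|) ^+ 2 by rewrite exprMn real_normK ?num_real// /g; ring.
  move=> le1; rewrite -(real_normK (num_real (u x - v n x))) ler_sqr ?nnegrE ?mulr_ge0//.
  by rewrite (le_trans (ler_normB _ _))//; lra.
rewrite integral0 => cI.
have : 2 * int01 (fun x => (u x - v n x) ^+ 2) @[n --> \oo] --> (2 * 0 : R).
  apply: cvgM; first exact: cvg_cst.
  exact: (fine_cvg cI).
rewrite mulr0 => c0.
by apply: (cvgr_to_ge c0); apply: nearW.
Qed.

End plancherel.

(** * Plancherel's identity for indicators of intervals *)

Section plancherel_dense.
Context {R : realType}.
Notation mu := (@lebesgue_measure R).
Notation D := (`[0, 1]%classic : set R).
Notation P := (`]0, +oo[%classic : set R).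
Notation int01 f := (Rintegral mu D f).
Implicit Types (p q u : R -> R) (w a : R) (A : set (measurableTypeR R)).

Lemma sqint_indic A : measurable A -> sqint (\1_A : R -> R).
Proof.
move=> mA; apply: (@sqint_bounded _ _ 1) => [|x _]; first exact: measurable_indic.
by rewrite indicE ger0_norm// lern1 leq_b1.
Qed.

(** Closed half-lines are stable under intersection and generate the Borel sets, while on the unit
    interval they reduce to intervals with an explicit transform. *)
Definition ray a : R -> R := \1_(`[a, +oo[%classic : set R).

Lemma sqint_ray a : sqint (ray a).
Proof. by apply: sqint_indic; exact: measurable_itv. Qed.

Lemma int01_ray (k : R -> R) a : 0 <= a ->
  int01 (fun x => ray a x * k x) = \int[mu]_(x in `[a, 1]) k x.
Proof.
move=> a0.
have -> : `[a, 1]%classic = D `&` `[a, +oo[%classic.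
  apply/seteqP; split => x /=; rewrite !in_itv/= ?andbT.
    by move=> /andP[ax x1]; rewrite x1 ax (le_trans a0 ax).
  by move=> [/andP[_ ->] ->].
rewrite Rintegral_mkcondr; apply: eq_Rintegral => x _.
by rewrite /ray patchE indicE; case: ifP => _; rewrite ?mul1r ?mul0r.
Qed.

Lemma ft_ray a w : 0 <= a -> a <= 1 -> w != 0 ->
  ft 0 (ray a) (fun=> 0) w = (sin (2 * pi * w) - sin (2 * pi * w * a)) / (2 * pi * w).
Proof.
move=> a0 a1 w0; rewrite /ft.
transitivity (int01 (fun x => ray a x * tc 0 w x)).
  by apply: eq_Rintegral => x _; rewrite mul0r addr0.
rewrite int01_ray//.
have dF (x : R) : a <= x <= 1 ->
    is_derive x (1 : R) (fun x => (2 * pi * w)^-1 * ts 0 w x) (tc 0 w x).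
  move=> _; rewrite /ts /tc; apply: is_derive_eq.
  rewrite /GRing.scale/=; move: (pi : R) (@pi_neq0 R) => Q Q0.
  by field; rewrite w0 Q0.
rewrite (Rintegral_is_derive a1 dF); last first.
  by apply: continuous_subspaceT; exact: continuous_tc.
by rewrite /ts !subr0 mulr1 -mulrBr mulrC.
Qed.

Lemma ft_ray' a w : 0 <= a -> a <= 1 -> w != 0 ->
  ft 0 (fun=> 0) (fun x => - ray a x) w =
  (cos (2 * pi * w) - cos (2 * pi * w * a)) / (2 * pi * w).
Proof.
move=> a0 a1 w0; rewrite /ft.
transitivity (int01 (fun x => ray a x * - ts 0 w x)).
  by apply: eq_Rintegral => x _; rewrite mul0r add0r mulNr mulrN.
rewrite int01_ray//.
have dF (x : R) : a <= x <= 1 ->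
    is_derive x (1 : R) (fun x => (2 * pi * w)^-1 * tc 0 w x) (- ts 0 w x).
  move=> _; rewrite /ts /tc; apply: is_derive_eq.
  rewrite /GRing.scale/=; move: (pi : R) (@pi_neq0 R) => Q Q0.
  by field; rewrite w0 Q0.
rewrite (Rintegral_is_derive a1 dF); last first.
  by apply: continuous_subspaceT => x; apply: cvgN; exact: continuous_ts.
by rewrite /tc !subr0 mulr1 -mulrBr mulrC.
Qed.

(** The numerator is a chord of the unit circle subtending the angle [2 pi (1 - a) w], of length
    [2 |sin (pi (1 - a) w)|]. *)
Lemma nft_ray a w : 0 <= a -> a <= 1 -> w != 0 ->
  nft 0 (ray a) (fun=> 0) w =
  (pi ^+ 2)^-1 * (sin (pi * (1 - a) * w) ^+ 2 / w ^+ 2).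
Proof.
move=> a0 a1 w0; rewrite /nft ft_ray// ft_ray'//.
have dbl : cos (2 * pi * w) * cos (2 * pi * w * a) +
    sin (2 * pi * w) * sin (2 * pi * w * a) = 1 - 2 * sin (pi * (1 - a) * w) ^+ 2.
  rewrite -cosB (_ : 2 * pi * w - _ = pi * (1 - a) * w + pi * (1 - a) * w); last by ring.
  by rewrite cosD -!expr2 cos2sin2; ring.
have h1 := cos2Dsin2 (2 * pi * w); have h2 := cos2Dsin2 (2 * pi * w * a).
set s1 := sin (2 * pi * w) in dbl h1 *; set c1 := cos (2 * pi * w) in dbl h1 *.
set s2 := sin _ in dbl h2 *; set c2 := cos _ in dbl h2 *.
move: (sin (pi * (1 - a) * w)) dbl => S dbl.
rewrite !expr_div_n -mulrDl.
have -> : (s1 - s2) ^+ 2 + (c1 - c2) ^+ 2 = 4 * S ^+ 2.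
  transitivity ((c1 ^+ 2 + s1 ^+ 2) + (c2 ^+ 2 + s2 ^+ 2) - 2 * (c1 * c2 + s1 * s2)).
    by ring.
  by rewrite h1 h2 dbl; ring.
move: (pi : R) (@pi_neq0 R) => Q Q0; by field; rewrite w0 Q0.
Qed.

Lemma nft_even u w : sqint u -> nft 0 u (fun=> 0) (- w) = nft 0 u (fun=> 0) w.
Proof.
move=> hu; rewrite /nft; congr (_ + _).
  congr (_ ^+ 2); apply: eq_Rintegral => x _.
  by rewrite /tc !subr0 !mul0r !mulrN !mulNr cosN.
rewrite -[RHS]sqrrN; congr (_ ^+ 2).
rewrite -(ftN 0 w (@sqint_cst R 0) (sqintN hu)); apply: eq_Rintegral => x _.
by rewrite oppr0 !mul0r /ts !subr0 !mulrN !mulNr sinN mulrN opprK.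
Qed.

Lemma continuous_sin2_div (c x : R) : 0 < x ->
  {for x, continuous (fun w => sin (c * w) ^+ 2 / w ^+ 2)}.
Proof.
move=> x0; apply: cvgM.
  apply: (@continuous_comp _ _ _ (fun w => sin (c * w)) (fun y => y ^+ 2)).
    by apply: derivable_continuous_at; exact: ex_derive.
  exact: exprn_continuous.
by apply: cvgV; [rewrite expf_neq0// gt_eqF|exact: exprn_continuous].
Qed.

Lemma measurable_sin2_div (c : R) : mfunR P (fun w => sin (c * w) ^+ 2 / w ^+ 2).
Proof.
apply: open_continuous_measurable_fun; first exact: interval_open.
move=> x; rewrite inE/= in_itv/= andbT; exact: continuous_sin2_div.
Qed.

(** Only the trace on the unit interval matters, so [a] may be taken in [[0, 1]]. By evenness the
    integral of the transform is twice [pi ^- 2 * (pi * (pi * (1 - b)) / 2)], that is [1 - b], the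
    squared norm. *)
Lemma null_ray a : null (ray a).
Proof.
suff H b : 0 <= b -> b <= 1 -> null (ray b).
  have [a0|a0] := ltP a 0.
    apply: eq_null (H 0 _ _) => // x; rewrite /= in_itv/= => /andP[x0 _].
    by rewrite /ray !indicE !mem_set//= in_itv/= andbT// (le_trans _ x0)// ltW.
  have [a1|a1] := leP a 1; first exact: H.
  apply: eq_null null0 => x; rewrite /= in_itv/= => /andP[_ x1].
  by rewrite /ray indicE memNset//= in_itv/= andbT leNgt (le_lt_trans x1 a1).
move=> b0 b1'; split; first exact: sqint_ray.
have s0 := @sqint_cst R 0.
have e1 : nsq (ray b) (fun=> 0) = 1 - b.
  transitivity (int01 (fun x => ray b x * 1)).
    apply: eq_Rintegral => x _; rewrite /ray indicE expr0n addr0 mulr1.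
    by case: (_ \in _); rewrite ?expr1n ?expr0n.
  rewrite int01_ray// (@Rintegral_is_derive _ _ id _ _ b1')//.
    by move=> x; exact: cst_continuous.
move: b1'; rewrite le_eqVlt => /predU1P[b1|b1].
  (* At [b = 1] the squared norm is already 0; the sine integral is available only for
     [1 - b > 0]. *)
  apply: le_anti; apply/andP; split; last exact: defect_ge0 (sqint_ray b) s0.
  by have := defect_le (ray b) (fun=> 0); rewrite e1 b1 subrr.
have b1' := ltW b1.
have c0 : 0 < pi * (1 - b) by rewrite mulr_gt0 ?pi_gt0// subr_gt0.
have e2 : (\int[mu]_w (nft 0 (ray b) (fun=> 0) w)%:E = (1 - b)%:E)%E.
  rewrite ge0_symfun_integralT; last 3 first.
  - by move=> w; exact: nft_ge0.
  - by apply: continuous_nft => //; exact: sqint_ray.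
  - by move=> w /=; rewrite nft_even//; exact: sqint_ray.
  rewrite -set_itvcy -integral_itv_obnd_cbnd; last first.
    apply/measurable_EFinP; apply: measurable_funTS; apply: measurable_nft => //.
    exact: sqint_ray.
  rewrite (_ : integral _ _ _ = \int[mu]_(w in P)
      ((pi ^+ 2)^-1 * (sin (pi * (1 - b) * w) ^+ 2 / w ^+ 2))%:E)%E; last first.
    apply: eq_integral => w; rewrite inE/= in_itv/= andbT => w0.
    by rewrite nft_ray// gt_eqF.
  rewrite integral_itvoyZl; last 3 first.
  - by rewrite invr_ge0 sqr_ge0.
  - exact: measurable_sin2_div.
  - by move=> x _; rewrite divr_ge0 ?sqr_ge0.
  rewrite (integral_sin2_div c0) -!EFinM; congr EFin.
  move: (pi : R) (@pi_neq0 R) => Q Q0; by field.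
by rewrite /defect e1 /Rintegral e2 subrr.
Qed.

End plancherel_dense.

(** * From intervals to all square-integrable functions *)

Section plancherel_full.
Import HBNNSimple.
Context {R : realType}.
Notation mu := (@lebesgue_measure R).
Notation D := (`[0, 1]%classic : set R).
Notation int01 f := (Rintegral mu D f).
Implicit Types (p q u : R -> R) (w a : R) (A : set (measurableTypeR R)).

Lemma partial_sum_indic (F : nat -> set (measurableTypeR R)) (x : R) n m :
  trivIset setT F -> F m x ->
  \sum_(0 <= k < n) \1_(F k) x = (m < n)%:R :> R.
Proof.
move=> tF Fmx.
have E k : (\1_(F k) x : R) = (k == m)%:R.
  rewrite indicE; have [->|km] := eqVneq k m; first by rewrite mem_set.
  rewrite memNset// => Fkx; move/eqP: km; apply.
  by apply: tF => //; exists x.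
under eq_bigr do rewrite E.
elim: n => [|n IH]; first by rewrite big_geq// ltn0.
rewrite big_nat_recr//= IH -natrD ltnS; congr (_%:R).
by case: (ltngtP m n).
Qed.

(** Dynkin's theorem: sets with a null indicator are stable under complement, as null functions form
    a linear space containing 1, and under countable disjoint union, as the partial sums are
    dominated by the indicator of the union. *)
Lemma null_indic A : measurable A -> null (\1_A : R -> R).
Proof.
pose G := @RGenCInfty.G R.
have GE : @measurable _ (measurableTypeR R) = <<s G >>.
  exact: (@RGenCInfty.measurableE R).
have GI : setI_closed G.
  move=> _ _ [a ->] [b ->]; exists (Num.max a b).
  apply/seteqP; split => x /=; rewrite !in_itv/= !andbT ge_max.
    by move=> [-> ->].
  by move=> /andP[-> ->].
move=> mA; have sA : <<s G >> A by rewrite -GE.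
apply: (@dynkin_induction _ (measurableTypeR R) G (fun A => null (\1_A : R -> R)) GE GI _ _ _ _ A sA).
- apply: eq_null (null_ray 0) => x; rewrite /= in_itv/= => /andP[x0 _].
  by rewrite /ray !indicE !mem_set//= in_itv/= x0.
- by move=> _ [a ->]; exact: null_ray.
- move=> S mS nS.
  have n1 : null (fun=> 1 : R).
    apply: eq_null (null_ray 0) => x; rewrite /= in_itv/= => /andP[x0 _].
    by rewrite /ray !indicE !mem_set//= in_itv/= x0.
  apply: eq_null (nullD n1 (nullZ (-1) nS)) => x _.
  by rewrite !indicE in_setC; case: (_ \in _); rewrite /= ?mulr1 ?mulr0 ?addr0 ?subrr.
- move=> F mF tF nF.
  have mU : measurable (\bigcup_k F k) by exact: bigcupT_measurable.
  pose v n x := \sum_(0 <= k < n) (\1_(F k) x : R).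
  have vE x m n : F m x -> v n x = (m < n)%:R by exact: partial_sum_indic.
  have v0 x n : ~ (\bigcup_k F k) x -> v n x = 0.
    move=> nFx; rewrite /v big1// => k _; rewrite indicE memNset// => Fkx.
    by apply: nFx; exists k.
  apply: (@null_dominated _ v); first by move=> n; exact: null_sum.
  + exact: sqint_indic.
  + move=> n x _; have [[m _ Fmx]|nFx] := pselect ((\bigcup_k F k) x).
      rewrite (vE x m)// indicE mem_set; last by exists m.
      by rewrite normr1 ger0_norm// lern1 leq_b1.
    by rewrite v0// normr0.
  + move=> x _; have [[m _ Fmx]|nFx] := pselect ((\bigcup_k F k) x).
      rewrite indicE mem_set; last by exists m.
      apply: cvg_near_cst; exists m.+1 => // n /= mn.
      by rewrite (vE x m)// mn.
    rewrite indicE memNset//.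
    by apply: cvg_near_cst; apply: nearW => n; rewrite v0.
Qed.

(** [u] is an increasing limit of simple functions, which are finite combinations of null indicators
    and stay below [u]. *)
Lemma null_ge0 u : sqint u -> (forall x, 0 <= u x) -> null u.
Proof.
move=> hu u0.
have mu' : @measurable_fun _ _ (measurableTypeR R) _ D (EFin \o u).
  exact: measurable_int (sqint_rint hu).
pose g := nnsfun_approx (measurable01 : measurable (D : set (measurableTypeR R))) mu'.
have u0' x : D x -> (0 <= (EFin \o u) x)%E by rewrite lee_fin.
have gu x : D x -> (EFin \o g^~ x) n @[n --> \oo] --> (u x)%:E.
  by move=> Dx; exact: (cvg_nnsfun_approx measurable01 mu' u0' Dx).
have gu' x : D x -> g n x @[n --> \oo] --> u x.
  by move=> /gu /fine_cvg.
apply: (@null_dominated _ (fun n => g n)) => //.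
- move=> n.
  have nA r : null (\1_(g n @^-1` [set r]) : R -> R).
    by apply: null_indic; exact: measurable_sfunP.
  have -> : (g n : R -> R) = _ := funext (fimfunEord (g n)).
  by apply: null_sum => i; exact: nullZ.
- move=> n x Dx; rewrite !ger0_norm//.
  rewrite -(cvg_lim (@Rhausdorff R) (gu' x Dx)).
  apply: (@nondecreasing_cvgn_le R (fun n => g n x)).
    move=> a b ab; have /lefP := nd_nnsfun_approx measurable01 mu' ab; exact.
  by apply/cvg_ex; exists (u x); exact: gu'.
Qed.

Lemma null_sqint u : sqint u -> null u.
Proof.
move=> hu.
have split x : u x = `|u x| + (-1) * (`|u x| - u x) by ring.
have ha : sqint (fun x => `|u x|).
  split.
    by apply: measurableT_comp => //; exact: hu.1.
  by apply: (eq_rint measurable01 _ hu.2) => x _; rewrite real_normK ?num_real.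
apply: (@eq_null _ (fun x => `|u x| + (-1) * (`|u x| - u x))).
  by move=> x _; rewrite -split.
apply: nullD; first by apply: null_ge0.
apply: nullZ; apply: null_ge0; first exact: sqintB.
by move=> x; rewrite subr_ge0 ler_norm.
Qed.

Theorem plancherel p q : sqint p -> sqint q ->
  \int[mu]_w nft 0 p q w = nsq p q.
Proof.
move=> hp hq; have s0 := @sqint_cst R 0.
have dp := (null_sqint hp).2.
(* The pair [(0, q)] is [i q]: multiplication by [i] changes neither the norm nor the modulus of the
   transform. *)
have dq : defect (fun=> 0) q = 0.
  refine (etrans (congr2 (fun x y => x - y) _ _) (null_sqint hq).2).
    by apply: eq_Rintegral => x _; rewrite addrC.
  apply: eq_Rintegral => w _; rewrite /nft addrC; congr (_ + _).
    by congr (_ ^+ 2); apply: eq_Rintegral => x _; rewrite /= oppr0.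
  rewrite -[LHS]sqrrN; congr (_ ^+ 2).
  rewrite -(ftN 0 w s0 hq).
  by apply: eq_Rintegral => x _; rewrite /= oppr0.
have := defectD_le hp s0 s0 hq; rewrite dp dq !mulr0 addr0.
have -> : defect (fun x => p x + 0) (fun x => 0 + q x) = defect p q.
  by apply: eq_defect => x _; rewrite ?addr0 ?add0r.
move=> d0; apply/eqP; rewrite eq_sym -subr_eq0; apply/eqP.
by apply: le_anti; apply/andP; split; [exact: d0|exact: defect_ge0 hp hq].
Qed.

End plancherel_full.

(** * Wirtinger's inequality and sampling *)

Section wirtinger.
Context {R : realType}.
Notation mu := (@lebesgue_measure R).
Implicit Types (u psi h : R -> R) (a b c k x : R).

Lemma rint_cont h a b : continuous h -> rint mu `[a, b] h.
Proof. by move=> ch; apply: rint_continuous; exact: continuous_subspaceT. Qed.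

(* [psi] solves a Riccati equation, so that
   [u' ^+ 2 - k ^+ 2 * u ^+ 2 = (u' - psi * u) ^+ 2 + (psi * u ^+ 2)']. *)
Lemma riccati_ineq u u' psi a b k : a <= b ->
  (forall x, is_derive x (1 : R) u (u' x)) -> continuous u' ->
  (forall x, a <= x <= b -> is_derive x (1 : R) psi (- (k ^+ 2 + psi x ^+ 2))) ->
  psi a * u a ^+ 2 <= psi b * u b ^+ 2 ->
  k ^+ 2 * \int[mu]_(x in `[a, b]) (u x ^+ 2) <= \int[mu]_(x in `[a, b]) (u' x ^+ 2).
Proof.
move=> ab du cu' dpsi bd.
have cu : continuous u by move=> x; apply: derivable_continuous_at; have /@ex_derive := du x.
have cpsi : {within `[a, b], continuous psi} by exact: within_is_derive_continuous dpsi.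
pose f x := - (k ^+ 2 + psi x ^+ 2) * u x ^+ 2 + psi x * (2 * u x * u' x).
have dF x : a <= x <= b -> is_derive x (1 : R) (fun x => psi x * u x ^+ 2) (f x).
  move=> xab; have := dpsi x xab; have := du x => ? ?.
  by apply: is_derive_eq; rewrite /f /GRing.scale/=; ring.
have cU : {within `[a, b], continuous u} by exact: continuous_subspaceT.
have cU' : {within `[a, b], continuous u'} by exact: continuous_subspaceT.
have cf : {within `[a, b], continuous f}.
  move=> x; apply: (@cvgD _ R^o).
    apply: cvgM; last by apply: cvgM; exact: cU.
    apply: (@cvgN _ R^o); apply: (@cvgD _ R^o); first exact: cvg_cst.
    by apply: cvgM; exact: cpsi.
  apply: cvgM; first exact: cpsi.
  apply: cvgM; last exact: cU'.
  by apply: cvgM; [exact: cvg_cst|exact: cU].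
have iu : rint mu `[a, b] (fun x => u x ^+ 2).
  by apply: rint_cont => x; apply: cvgM; exact: cu.
have iu' : rint mu `[a, b] (fun x => u' x ^+ 2).
  by apply: rint_cont => x; apply: cvgM; exact: cu'.
have mI : measurable (`[a, b]%classic : set (measurableTypeR R)) by exact: measurable_itv.
have ik := rintZ mI (k ^+ 2) iu.
have If := rint_continuous cf.
have E := Rintegral_is_derive ab dF cf.
have Ek := RintegralZl (k ^+ 2) mI iu.
have Es := RintegralD mI ik If.
have le : \int[mu]_(x in `[a, b]) (k ^+ 2 * u x ^+ 2 + f x) <=
          \int[mu]_(x in `[a, b]) (u' x ^+ 2).
  apply: le_Rintegral => //; first exact: rintD.
  move=> x _; rewrite -subr_ge0.
  rewrite (_ : _ - _ = (u' x - psi x * u x) ^+ 2) ?sqr_ge0//.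
  by rewrite /f; ring.
rewrite -Ek -[leLHS]addr0; apply: le_trans le; rewrite Es lerD2l E.
by rewrite subr_ge0.
Qed.

(** The Riccati solution [k tan (k (b - x))] vanishes at the free end [b] and [u] vanishes at [a],
    so no boundary term remains; [k (b - a) < pi / 2] keeps the tangent finite. *)
Lemma wirtinger_left_end u u' a b k : a <= b ->
  (forall x, is_derive x (1 : R) u (u' x)) -> continuous u' ->
  0 <= k -> k * (b - a) < pi / 2 -> u a = 0 ->
  k ^+ 2 * \int[mu]_(x in `[a, b]) (u x ^+ 2) <= \int[mu]_(x in `[a, b]) (u' x ^+ 2).
Proof.
move=> ab du cu' k0 kpi ua.
refine (@riccati_ineq u u' (fun x => k * tan (k * (b - x))) a b k ab du cu' _ _); last first.
  by rewrite ua subrr mulr0 tan0 mulr0 mul0r expr0n/= mulr0.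
move=> x /andP[ax xb].
have c0 : cos (k * (b - x)) != 0.
  rewrite gt_eqF// cos_gt0_pihalf//; apply/andP; split.
    by rewrite (lt_le_trans (y := 0)) ?oppr_lt0 ?divr_gt0 ?pi_gt0// mulr_ge0// subr_ge0.
  by rewrite (le_lt_trans _ kpi)// ler_wpM2l// lerD2l lerN2.
have := is_derive_tan c0 => ?.
apply: is_derive_eq; rewrite /GRing.scale/= cos2_tan2//; ring.
Qed.

Lemma wirtinger_right_end u u' a b k : a <= b ->
  (forall x, is_derive x (1 : R) u (u' x)) -> continuous u' ->
  0 <= k -> k * (b - a) < pi / 2 -> u b = 0 ->
  k ^+ 2 * \int[mu]_(x in `[a, b]) (u x ^+ 2) <= \int[mu]_(x in `[a, b]) (u' x ^+ 2).
Proof.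
move=> ab du cu' k0 kpi ub.
refine (@riccati_ineq u u' (fun x => - (k * tan (k * (x - a)))) a b k ab du cu' _ _); last first.
  by rewrite ub subrr mulr0 tan0 mulr0 oppr0 mul0r expr0n/= mulr0.
move=> x /andP[ax xb].
have c0 : cos (k * (x - a)) != 0.
  rewrite gt_eqF// cos_gt0_pihalf//; apply/andP; split.
    by rewrite (lt_le_trans (y := 0)) ?oppr_lt0 ?divr_gt0 ?pi_gt0// mulr_ge0// subr_ge0.
  by rewrite (le_lt_trans _ kpi)// ler_wpM2l// lerD2r.
have := is_derive_tan c0 => ?.
apply: is_derive_eq; rewrite /GRing.scale/= cos2_tan2//; ring.
Qed.

(** [u - u c] vanishes at [c], a common end of the two pieces of the cell. Each piece has length at
    most [delta / 2], and [c] need not be the midpoint. *)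
Lemma wirtinger_cell u u' a b c k delta :
  a <= c <= b -> c - a <= delta / 2 -> b - c <= delta / 2 ->
  (forall x, is_derive x (1 : R) u (u' x)) -> continuous u' ->
  0 <= k -> k * delta < pi ->
  k ^+ 2 * \int[mu]_(x in `[a, b]) ((u x - u c) ^+ 2) <=
  \int[mu]_(x in `[a, b]) (u' x ^+ 2).
Proof.
move=> /andP[ac cb] ca bc du cu' k0 kd.
have dv x : is_derive x (1 : R) (fun x => u x - u c) (u' x).
  by have := du x => ?; apply: is_derive_eq; rewrite subr0.
have cv : continuous (fun x => u x - u c).
  by move=> x; apply: derivable_continuous_at; have /@ex_derive := dv x.
have kd2 t : t <= delta / 2 -> k * t < pi / 2.
  by move=> td; rewrite (le_lt_trans (ler_wpM2l k0 td))// mulrA ltr_pM2r.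
have l1 := wirtinger_right_end ac dv cu' k0 (kd2 _ ca) (subrr _).
have l2 := wirtinger_left_end cb dv cu' k0 (kd2 _ bc) (subrr _).
have s1 := @Rintegral_split _ (fun x => (u x - u c) ^+ 2) a c b ac cb.
have s2 := @Rintegral_split _ (fun x => u' x ^+ 2) a c b ac cb.
rewrite s1; last by apply: rint_cont => x; apply: cvgM; exact: cv.
rewrite s2; last by apply: rint_cont => x; apply: cvgM; exact: cu'.
by rewrite mulrDr lerD.
Qed.

End wirtinger.

(** * Optimising over a real parameter *)

Section real_lemmas.
Context {R : realType}.
Implicit Types (a b x t : R).

(** The right side is the infimum over [t] of the bounds, attained at [t = sqrt b / sqrt a]. If [a]
    or [b] is 0 it is only approached, and [t] is chosen to leave an error of at most [e]. *)
Lemma le_sqr_sqrtD x a b : 0 <= a -> 0 <= b ->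
  (forall t, 0 < t -> x <= (1 + t) * a + (1 + t^-1) * b) ->
  x <= (Num.sqrt a + Num.sqrt b) ^+ 2.
Proof.
move=> a0 b0 H; rewrite sqrrD !sqr_sqrtr//.
have [az|ap] := eqVneq a 0.
  rewrite az sqrtr0 mul0r mul0rn addr0 add0r.
  apply/ler_addgt0Pr => e e0.
  have t0 : 0 < (b + 1) / e by rewrite divr_gt0// ltr_wpDl.
  have := H _ t0; rewrite az mulr0 add0r mulrDl mul1r invfM invrK => /le_trans; apply.
  rewrite lerD2l mulrAC mulrC ler_piMr ?(ltW e0)//.
  by rewrite mulrC ler_pdivrMr ?mul1r ?lerDl// ltr_wpDl.
have [bz|bp] := eqVneq b 0.
  rewrite bz sqrtr0 mulr0 mul0rn !addr0.
  apply/ler_addgt0Pr => e e0.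
  have t0 : 0 < e / a by rewrite divr_gt0// lt0r ap.
  have := H _ t0; rewrite bz mulr0 addr0 => /le_trans; apply.
  by rewrite mulrDl mul1r divfK.
have sa : 0 < Num.sqrt a by rewrite sqrtr_gt0 lt0r ap.
have sb : 0 < Num.sqrt b by rewrite sqrtr_gt0 lt0r bp.
have t0 : 0 < Num.sqrt b / Num.sqrt a by rewrite divr_gt0.
have := H _ t0 => /le_trans; apply.
rewrite le_eqVlt; apply/orP; left; apply/eqP.
move: (sqr_sqrtr a0) (sqr_sqrtr b0) sa sb => {t0 H ap bp a0 b0}.
move: (Num.sqrt a) (Num.sqrt b) => r s <- <- r0 s0.
by field; rewrite !lt0r_neq0.
Qed.

(** This is the limit [k -> p / d], made by a single choice: if [r = d ^+ 2 * m / x < 1], then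
    [k = (1 + r) / 2 * (p / d)] contradicts the hypothesis, since [((1 + r) / 2) ^+ 2 - r = ((1 - r)
    / 2) ^+ 2 > 0]. *)
Lemma le_of_lt_ratio (p d x m : R) : 0 < p -> 0 < d -> 0 <= x ->
  (forall k, 0 <= k -> k * d < p -> k ^+ 2 * x <= p ^+ 2 * m) -> x <= d ^+ 2 * m.
Proof.
move=> p0 d0 x0 H; rewrite leNgt; apply/negP => lt.
have xp : 0 < x.
  rewrite lt0r x0 andbT; apply/eqP => xz; move: lt; rewrite xz.
  have := H 0 (lexx _); rewrite mul0r expr0n/= mul0r => /(_ p0).
  by rewrite pmulr_rge0 ?exprn_gt0// ltNge => m0; rewrite mulr_ge0 ?sqr_ge0.
have m0 : 0 <= m.
  by have := H 0 (lexx _); rewrite mul0r expr0n/= mul0r => /(_ p0); rewrite pmulr_rge0 ?exprn_gt0.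
pose r := d ^+ 2 * m / x.
have r0 : 0 <= r by rewrite divr_ge0// mulr_ge0// sqr_ge0.
have r1 : r < 1 by rewrite ltr_pdivrMr// mul1r.
have k0 : 0 <= (1 + r) / 2 * (p / d) by apply: mulr_ge0; [lra|rewrite divr_ge0// ltW].
have kd : (1 + r) / 2 * (p / d) * d < p.
  rewrite -mulrA divfK ?gt_eqF// gtr_pMl//.
  by rewrite ltr_pdivrMr// mul1r; lra.
have := H _ k0 kd; apply/negP; rewrite -ltNge -subr_gt0.
have -> : ((1 + r) / 2 * (p / d)) ^+ 2 * x - p ^+ 2 * m =
    (p / d) ^+ 2 * x * ((1 - r) / 2) ^+ 2.
  by rewrite /r; field; rewrite !gt_eqF.
apply: mulr_gt0; last by rewrite exprn_gt0//; lra.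
by apply: mulr_gt0 => //; rewrite exprn_gt0// divr_gt0.
Qed.

End real_lemmas.

(** * Integrals compared with weighted sums over cells *)

Section sampling.
Context {R : realType}.
Notation mu := (@lebesgue_measure R).
Notation D := (`[0, 1]%classic : set R).
Implicit Types (h A B p q : R -> R) (a b k t delta : R) (y c : nat -> R).

Lemma Rintegral_cells h y n : continuous h ->
  (forall i, (i < n)%N -> y i <= y i.+1) ->
  \int[mu]_(x in `[y 0%N, y n]) h x =
  \sum_(0 <= i < n) \int[mu]_(x in `[y i, y i.+1]) h x.
Proof.
move=> ch; elim: n => [_|n IH ly]; first by rewrite set_itv1 Rintegral_set1 big_geq.
have ly' i : (i < n)%N -> y i <= y i.+1 by move=> /ltnW; exact: ly.
have y0n : y 0%N <= y n.
  elim: {IH} n {ly} ly' => // n IHn ly'.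
  by rewrite (le_trans (IHn _)) ?ly'// => i /ltnW; exact: ly'.
rewrite big_nat_recr//= -IH//; apply: Rintegral_split => //; first exact: ly.
exact: rint_cont.
Qed.

Lemma Rintegral_le_subset (X Y : set (measurableTypeR R)) h :
  measurable X -> measurable Y -> X `<=` Y -> rint mu Y h -> (forall x, 0 <= h x) ->
  \int[mu]_(x in X) h x <= \int[mu]_(x in Y) h x.
Proof.
move=> mX mY XY ih h0.
have ihX : rint mu X h by exact: integrableS ih.
rewrite -lee_fin -(EFin_Rintegral mX ihX) -(EFin_Rintegral mY ih).
by apply: ge0_subset_integral => //; [exact: measurable_int ih|move=> x _; rewrite lee_fin].
Qed.

Lemma Rintegral_le_setT h a b : rint mu setT h -> (forall x, 0 <= h x) ->
  \int[mu]_(x in `[a, b]) h x <= \int[mu]_x h x.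
Proof.
move=> ih h0; apply: Rintegral_le_subset => //; exact: measurable_itv.
Qed.

Lemma sqr_le_young (v w t : R) : 0 < t ->
  v ^+ 2 <= (1 + t) * w ^+ 2 + (1 + t^-1) * (v - w) ^+ 2.
Proof.
move=> t0; rewrite -subr_ge0.
rewrite (_ : _ - _ = (t * w - (v - w)) ^+ 2 / t); last by field; rewrite gt_eqF.
by rewrite divr_ge0 ?sqr_ge0 ?ltW.
Qed.

Lemma Rintegral_young (f g d : R -> R) a b t :
  continuous f -> continuous g -> continuous d ->
  (forall x, f x <= (1 + t) * g x + (1 + t^-1) * d x) ->
  \int[mu]_(x in `[a, b]) f x <=
  (1 + t) * (\int[mu]_(x in `[a, b]) g x) + (1 + t^-1) * \int[mu]_(x in `[a, b]) d x.
Proof.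
move=> cf cg cd fgd.
have mI : measurable (`[a, b]%classic : set (measurableTypeR R)) by exact: measurable_itv.
have jf := rint_cont a b cf.
have jg := rint_cont a b cg; have jd := rint_cont a b cd.
have e1 := RintegralZl (1 + t) mI jg; have e2 := RintegralZl (1 + t^-1) mI jd.
have e3 := RintegralD mI (rintZ mI (1 + t) jg) (rintZ mI (1 + t^-1) jd).
rewrite -e1 -e2 -e3; apply: le_Rintegral => //.
by apply: rintD => //; exact: rintZ.
Qed.

Lemma Rintegral_cst_itv a b (r : R) : a <= b ->
  \int[mu]_(x in `[a, b]) r = (b - a) * r.
Proof.
move=> ab.
have dF (x : R) : a <= x <= b -> is_derive x (1 : R) (fun x => r * x) r.
  by move=> _; apply: is_derive_eq; rewrite /GRing.scale/= mulr1.
rewrite (Rintegral_is_derive ab dF) ?mulrBl 1?[r * b]mulrC 1?[r * a]mulrC//.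
by move=> x; exact: cst_continuous.
Qed.

Section cells.
Variables (y c : nat -> R) (n : nat) (delta : R).
Hypothesis yc : forall i, (i < n)%N -> y i <= c i <= y i.+1.
Hypothesis cy : forall i, (i < n)%N -> c i - y i <= delta / 2.
Hypothesis yc' : forall i, (i < n)%N -> y i.+1 - c i <= delta / 2.

Let y_le i : (i < n)%N -> y i <= y i.+1.
Proof. by move=> /yc/andP[]; exact: le_trans. Qed.

Section two_functions.
Variables A B : R -> R.
Hypotheses (cA : continuous A) (cB : continuous B).

Let dev i x := (A x - A (c i)) ^+ 2 + (B x - B (c i)) ^+ 2.

Let cdev i : continuous (dev i).
Proof.
move=> x; apply: cvgD; apply: cvgM; apply: cvgB; try exact: cvg_cst; [exact: cA..|exact: cB|exact: cB].
Qed.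

Let cAB : continuous (fun x => A x ^+ 2 + B x ^+ 2).
Proof. by move=> x; apply: cvgD; apply: cvgM; [exact: cA..|exact: cB|exact: cB]. Qed.

(** The squared distance of [A + i B] to the step function with value [A (c i) + i B (c i)] on cell
    [i]; [sampled] is the squared norm of that step function. *)
Definition deviation := \sum_(0 <= i < n) \int[mu]_(x in `[y i, y i.+1]) dev i x.

Definition sampled := \sum_(0 <= i < n)
  (y i.+1 - y i) * (A (c i) ^+ 2 + B (c i) ^+ 2).

(** One half of the triangle inequality between a function and its step function, squared and with
    the parameter [t] left free; [le_sampled] is the other half. *)
Lemma sampled_le t : 0 < t -> sampled <=
  (1 + t) * (\int[mu]_(x in `[y 0%N, y n]) (A x ^+ 2 + B x ^+ 2)) +
  (1 + t^-1) * deviation.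
Proof.
move=> t0; rewrite (Rintegral_cells cAB y_le) /sampled /deviation !mulr_sumr -big_split/=.
rewrite big_nat [leRHS]big_nat; apply: ler_sum => i /andP[_ ni].
rewrite -(Rintegral_cst_itv _ (y_le ni)).
apply: Rintegral_young => //; first by move=> x; exact: cst_continuous.
move=> x; have h1 := sqr_le_young (A (c i)) (A x) t0.
have h2 := sqr_le_young (B (c i)) (B x) t0.
by rewrite (le_trans (lerD h1 h2))// le_eqVlt; apply/orP; left; apply/eqP;
  rewrite /dev; ring.
Qed.

Lemma le_sampled t : 0 < t ->
  \int[mu]_(x in `[y 0%N, y n]) (A x ^+ 2 + B x ^+ 2) <=
  (1 + t) * sampled + (1 + t^-1) * deviation.
Proof.
move=> t0; rewrite (Rintegral_cells cAB y_le) /sampled /deviation !mulr_sumr -big_split/=.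
rewrite big_nat [leRHS]big_nat; apply: ler_sum => i /andP[_ ni].
rewrite -(Rintegral_cst_itv _ (y_le ni)).
apply: Rintegral_young => //; first by move=> x; exact: cst_continuous.
move=> x; have h1 := sqr_le_young (A x) (A (c i)) t0.
have h2 := sqr_le_young (B x) (B (c i)) t0.
by rewrite (le_trans (lerD h1 h2))// le_eqVlt; apply/orP; left; apply/eqP;
  rewrite /dev; ring.
Qed.

Lemma deviation_ge0 : 0 <= deviation.
Proof.
by apply: sumr_ge0 => i _; apply: Rintegral_ge0 => x _; rewrite addr_ge0 ?sqr_ge0.
Qed.

Lemma deviation_le A' B' k :
  (forall x, is_derive x (1 : R) A (A' x)) -> continuous A' ->
  (forall x, is_derive x (1 : R) B (B' x)) -> continuous B' ->
  0 <= k -> k * delta < pi ->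
  k ^+ 2 * deviation <= \int[mu]_(x in `[y 0%N, y n]) (A' x ^+ 2 + B' x ^+ 2).
Proof.
move=> dA cA' dB cB' k0 kd.
have cAB' : continuous (fun x => A' x ^+ 2 + B' x ^+ 2).
  by move=> x; apply: cvgD; apply: cvgM; [exact: cA'..|exact: cB'|exact: cB'].
rewrite (Rintegral_cells cAB' y_le) /deviation mulr_sumr.
rewrite big_nat [leRHS]big_nat; apply: ler_sum => i /andP[_ ni].
have w1 := wirtinger_cell (yc ni) (cy ni) (yc' ni) dA cA' k0 kd.
have w2 := wirtinger_cell (yc ni) (cy ni) (yc' ni) dB cB' k0 kd.
have mI : measurable (`[y i, y i.+1]%classic : set (measurableTypeR R)) by exact: measurable_itv.
have sq (f : R -> R) : continuous f -> rint mu `[y i, y i.+1] (fun x => f x ^+ 2).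
  by move=> cf; apply: rint_cont => x; apply: cvgM; exact: cf.
have e1 : \int[mu]_(x in `[y i, y i.+1]) dev i x =
  \int[mu]_(x in `[y i, y i.+1]) ((A x - A (c i)) ^+ 2) +
  \int[mu]_(x in `[y i, y i.+1]) ((B x - B (c i)) ^+ 2).
  by apply: RintegralD => //; apply: sq => x; apply: cvgB;
    [exact: cA|exact: cvg_cst|exact: cB|exact: cvg_cst].
have e2 := RintegralD mI (sq _ cA') (sq _ cB').
by rewrite e1 e2 mulrDr lerD.
Qed.

End two_functions.
End cells.

End sampling.

(** * The sampling operator *)

Section complex_integrals.
Context {R : realType}.
Notation mu := (@lebesgue_measure R).
Notation D := (`[0, 1]%classic : set R).
Notation C := (complex R).
Implicit Types (f g h : R -> C) (z : C) (w x : R).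

Lemma ReM (z1 z2 : C) : complex.Re (z1 * z2) =
  complex.Re z1 * complex.Re z2 - complex.Im z1 * complex.Im z2.
Proof. by case: z1; case: z2. Qed.

Lemma ImM (z1 z2 : C) : complex.Im (z1 * z2) =
  complex.Re z1 * complex.Im z2 + complex.Im z1 * complex.Re z2.
Proof. by case: z1; case: z2. Qed.

Lemma ReD (z1 z2 : C) : complex.Re (z1 + z2) = complex.Re z1 + complex.Re z2.
Proof. by case: z1; case: z2. Qed.

Lemma ImD (z1 z2 : C) : complex.Im (z1 + z2) = complex.Im z1 + complex.Im z2.
Proof. by case: z1; case: z2. Qed.

Lemma complexP (z1 z2 : C) : complex.Re z1 = complex.Re z2 ->
  complex.Im z1 = complex.Im z2 -> z1 = z2.
Proof. by case: z1 z2 => [a b] [c d] /= -> ->. Qed.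

Lemma Re_sum I (s : seq I) (F : I -> C) :
  complex.Re (\sum_(i <- s) F i) = \sum_(i <- s) complex.Re (F i).
Proof. by elim: s => [|i s IH]; rewrite ?big_nil// !big_cons ReD IH. Qed.

Lemma Im_sum I (s : seq I) (F : I -> C) :
  complex.Im (\sum_(i <- s) F i) = \sum_(i <- s) complex.Im (F i).
Proof. by elim: s => [|i s IH]; rewrite ?big_nil// !big_cons ImD IH. Qed.

Lemma cconjM (z1 z2 : C) : cconj (z1 * z2) = cconj z1 * cconj z2.
Proof. by apply: complexP; rewrite ?(ReM, ImM)/= ?(ReM, ImM)/=; ring. Qed.

Lemma cconj_sum I (s : seq I) (F : I -> C) :
  cconj (\sum_(i <- s) F i) = \sum_(i <- s) cconj (F i).
Proof.
apply: complexP; first by rewrite /= !Re_sum.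
by rewrite /= !Im_sum -sumrN.
Qed.

Lemma cconjK z : cconj (cconj z) = z.
Proof. by apply: complexP => //=; rewrite opprK. Qed.

Definition cintegrable h := rint mu D (fun x => complex.Re (h x)) /\
  rint mu D (fun x => complex.Im (h x)).

Lemma cintM_const z h : cintegrable h -> cint D (fun x => z * h x) = z * cint D h.
Proof.
move=> [hr hi].
have e1 := RintegralZl (complex.Re z) measurable01 hr.
have e2 := RintegralZl (complex.Im z) measurable01 hi.
have e3 := RintegralZl (complex.Re z) measurable01 hi.
have e4 := RintegralZl (complex.Im z) measurable01 hr.
have e5 := RintegralB measurable01 (rintZ measurable01 (complex.Re z) hr)
  (rintZ measurable01 (complex.Im z) hi).
have e6 := RintegralD measurable01 (rintZ measurable01 (complex.Re z) hi)
  (rintZ measurable01 (complex.Im z) hr).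
apply: complexP.
  rewrite ReM; refine (etrans _ (etrans e5 (congr2 (fun a b => a - b) e1 e2))).
  by apply: eq_Rintegral => x _; exact: ReM.
rewrite ImM; refine (etrans _ (etrans e6 (congr2 +%R e3 e4))).
by apply: eq_Rintegral => x _; exact: ImM.
Qed.

Lemma cintegrableM_const z h : cintegrable h -> cintegrable (fun x => z * h x).
Proof.
move=> [hr hi]; split.
  apply: (@eq_rint _ _ _ mu D measurable01 (fun x =>
    complex.Re z * complex.Re (h x) - complex.Im z * complex.Im (h x))).
    by move=> x _; rewrite ReM.
  by apply: rintB => //; exact: rintZ.
apply: (@eq_rint _ _ _ mu D measurable01 (fun x =>
  complex.Re z * complex.Im (h x) + complex.Im z * complex.Re (h x))).
  by move=> x _; rewrite ImM.
by apply: rintD => //; exact: rintZ.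
Qed.

Lemma cint_sum I (s : seq I) (F : I -> R -> C) : (forall i, cintegrable (F i)) ->
  cint D (fun x => \sum_(i <- s) F i x) = \sum_(i <- s) cint D (F i).
Proof.
move=> iF; apply: complexP.
  rewrite Re_sum /= -(Rintegral_sum measurable01 s (fun i => (iF i).1)).
  by apply: eq_Rintegral => x _; rewrite Re_sum.
rewrite Im_sum /= -(Rintegral_sum measurable01 s (fun i => (iF i).2)).
by apply: eq_Rintegral => x _; rewrite Im_sum.
Qed.

Lemma cintD f g : cintegrable f -> cintegrable g ->
  cint D (fun x => f x + g x) = cint D f + cint D g.
Proof.
move=> [fr fi] [gr gi]; apply: complexP.
  refine (etrans _ (etrans (RintegralD measurable01 fr gr) (esym (ReD (cint D f) (cint D g))))).
  by apply: eq_Rintegral => x _; exact: ReD.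
refine (etrans _ (etrans (RintegralD measurable01 fi gi) (esym (ImD (cint D f) (cint D g))))).
by apply: eq_Rintegral => x _; exact: ImD.
Qed.

Lemma eq_cint f g : (forall x, D x -> f x = g x) -> cint D f = cint D g.
Proof.
by move=> fg; apply: complexP; apply: eq_Rintegral => x /set_mem Dx; rewrite fg.
Qed.

Lemma cint_conj h : cintegrable h -> cint D (fun x => cconj (h x)) = cconj (cint D h).
Proof.
move=> [_ hi]; apply: complexP => //=.
have := RintegralZl (-1) measurable01 hi; rewrite mulN1r => <-.
by apply: eq_Rintegral => x _; rewrite mulN1r.
Qed.

Lemma Rintegral_supp01 (k : R -> R) : (forall x, ~ D x -> k x = 0) ->
  \int[mu]_x k x = \int[mu]_(x in D) k x.
Proof.
move=> k0; rewrite [RHS]Rintegral_mkcond; apply: eq_Rintegral => x _.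
by rewrite patchE; case: ifPn => // /negP; rewrite inE => /k0.
Qed.

Lemma cint_supp01 h : (forall x, ~ D x -> h x = 0) -> cint setT h = cint D h.
Proof.
by move=> h0; apply: complexP; apply: Rintegral_supp01 => x nx; rewrite h0.
Qed.

Definition csqint f := sqint (fun x => complex.Re (f x)) /\
  sqint (fun x => complex.Im (f x)).

Lemma cintegrableM f g : csqint f -> csqint g -> cintegrable (fun x => f x * g x).
Proof.
move=> [fr fi] [gr gi]; split.
  apply: (@eq_rint _ _ _ mu D measurable01 (fun x =>
    complex.Re (f x) * complex.Re (g x) - complex.Im (f x) * complex.Im (g x))).
    by move=> x _; rewrite ReM.
  by apply: rintB => //; exact: rint_mul.
apply: (@eq_rint _ _ _ mu D measurable01 (fun x =>
  complex.Re (f x) * complex.Im (g x) + complex.Im (f x) * complex.Re (g x))).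
  by move=> x _; rewrite ImM.
by apply: rintD => //; exact: rint_mul.
Qed.

Lemma csqint_conj f : csqint f -> csqint (fun x => cconj (f x)).
Proof. by move=> [fr fi]; split => //; exact: sqintN. Qed.

Lemma csqintD f g : csqint f -> csqint g -> csqint (fun x => f x + g x).
Proof.
move=> [fr fi] [gr gi]; split.
  by apply: eq_sqint (sqintD fr gr) => x _; rewrite ReD.
by apply: eq_sqint (sqintD fi gi) => x _; rewrite ImD.
Qed.

Lemma csqintZ z f : csqint f -> csqint (fun x => z * f x).
Proof.
move=> [fr fi]; split.
  by apply: eq_sqint (sqintB (sqintZ _ fr) (sqintZ _ fi)) => x _; rewrite ReM.
by apply: eq_sqint (sqintD (sqintZ _ fi) (sqintZ _ fr)) => x _; rewrite ImM.
Qed.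

Lemma csqint_sum I (s : seq I) (F : I -> R -> C) : (forall i, csqint (F i)) ->
  csqint (fun x => \sum_(i <- s) F i x).
Proof.
move=> hF; elim: s => [|i s [IHr IHi]].
  by split; apply: eq_sqint (sqint_cst 0) => x _; rewrite big_nil.
have [hr hi] := csqintD (hF i) (conj IHr IHi).
by split; [apply: eq_sqint hr|apply: eq_sqint hi] => x _; rewrite big_cons.
Qed.

Definition expw w x : C := cexpi (2 * pi * w * x).

Lemma Re_expw w x : complex.Re (expw w x) = tc 0 w x.
Proof. by rewrite /tc subr0. Qed.

Lemma Im_expw w x : complex.Im (expw w x) = ts 0 w x.
Proof. by rewrite /ts subr0. Qed.

Lemma csqint_expw w : csqint (expw w).
Proof.
split.
  by apply: eq_sqint (sqint_tc 0 w) => x _; rewrite Re_expw.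
by apply: eq_sqint (sqint_ts 0 w) => x _; rewrite Im_expw.
Qed.

(** Reduces membership in the function space to the unit interval, where the Fourier results are
    stated; extension by 0 preserves measurability. *)
Lemma inHP f : inH f <-> csqint f /\ (forall x, ~ D x -> f x = 0).
Proof.
split=> [[[mr [mi fin]] f0]|[[hr hi] f0]].
  have mr' : mfunR setT (fun x => complex.Re (f x)) by exact: mr.
  have mi' : mfunR setT (fun x => complex.Im (f x)) by exact: mi.
  have ic : rint mu setT (fun x => csq (f x)).
    apply: ge0_rint => //; last by move=> x _; rewrite addr_ge0 ?sqr_ge0.
    by apply: measurable_funD; exact: measurable_funX.
  have ic01 : rint mu D (fun x => csq (f x)) by exact: integrableS ic.
  split; last by move=> x nDx; apply: f0; move: nDx; rewrite /= in_itv.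
  split; split; try exact: measurable_funTS.
    apply: (rint_le measurable01 _ _ ic01).
      by apply: measurable_funX; exact: measurable_funTS.
    by move=> x _; rewrite ger0_norm ?sqr_ge0// lerDl sqr_ge0.
  apply: (rint_le measurable01 _ _ ic01).
    by apply: measurable_funX; exact: measurable_funTS.
  by move=> x _; rewrite ger0_norm ?sqr_ge0// lerDr sqr_ge0.
have mT (k : R -> R) : mfunR D k -> (forall x, ~ D x -> k x = 0) -> mfunR setT k.
  move=> mk k0; have := (measurable_restrictT k measurable01).1 mk.
  rewrite (_ : k \_ D = k)//; apply/funext => x.
  by rewrite patchE; case: ifPn => // /negP; rewrite inE => /k0.
split; last by move=> x nx; apply: f0; rewrite /= in_itv.
split; last split.
- by apply: mT => [|x nx]; [exact: hr.1|rewrite f0].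
- by apply: mT => [|x nx]; [exact: hi.1|rewrite f0].
- have -> : (\int[mu]_x (csq (f x))%:E = \int[mu]_(x in D) (csq (f x))%:E)%E.
    rewrite [RHS]integral_mkcond; apply: eq_integral => x _.
    rewrite patchE; case: ifPn => // /negP; rewrite inE => /f0 ->.
    by rewrite /csq/= expr0n addr0.
  rewrite (EFin_Rintegral measurable01) ?ltry//.
  exact: rint_nsq hr hi.
Qed.

Notation re f := (fun x => complex.Re (f x)).
Notation im f := (fun x => complex.Im (f x)).

Lemma fhatE f w : inH f -> fhat f w =
  Complex (ft 0 (re f) (im f) w) (ft 0 (im f) (fun x => - complex.Re (f x)) w).
Proof.
move=> /inHP[_ f0]; rewrite /fhat cint_supp01; last by move=> x /f0 ->; rewrite mul0r.
apply: complexP; apply: eq_Rintegral => x _.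
  by rewrite ReM /= /tc /ts subr0 cosN sinN; ring.
by rewrite ImM /= /tc /ts subr0 cosN sinN; ring.
Qed.

Lemma csq_fhat f w : inH f -> csq (fhat f w) = nft 0 (re f) (im f) w.
Proof. by move=> /fhatE ->. Qed.

Lemma fhat_cint f w : inH f -> fhat f w = cint D (fun x => f x * cconj (expw w x)).
Proof.
move=> /inHP[_ f0]; rewrite /fhat cint_supp01; last by move=> x /f0 ->; rewrite mul0r.
apply: eq_cint => x _; congr (_ * _).
by apply: complexP; rewrite /= ?cosN ?sinN.
Qed.

Lemma l2normE f : inH f -> l2norm f = Num.sqrt (nsq (re f) (im f)).
Proof.
move=> /inHP[_ f0]; rewrite /l2norm Rintegral_supp01// => x /f0 ->.
by rewrite /csq/= expr0n addr0.
Qed.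

Lemma sqr_l2norm f : inH f -> l2norm f ^+ 2 = nsq (re f) (im f).
Proof. by move=> /l2normE ->; rewrite sqr_sqrtr// nsq_ge0. Qed.

Lemma ipE f g : inH f -> ip f g = cint D (fun x => f x * cconj (g x)).
Proof.
by move=> /inHP[_ f0]; rewrite /ip cint_supp01// => x /f0 ->; rewrite mul0r.
Qed.

Lemma ip_self f : inH f -> complex.Re (ip f f) = l2norm f ^+ 2.
Proof.
move=> hf; rewrite (ipE _ hf) sqr_l2norm//; apply: eq_Rintegral => x _.
by rewrite ReM/=; ring.
Qed.

Lemma inH_linear z f g : inH f -> inH g -> inH (fun x => z * f x + g x).
Proof.
move=> /inHP[hf f0] /inHP[hg g0]; apply/inHP; split.
  by apply: csqintD => //; exact: csqintZ.
by move=> x nx; rewrite f0// g0// mulr0 addr0.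
Qed.

Lemma inH_sum I (s : seq I) (c : I -> C) (F : I -> R -> C) : (forall i, inH (F i)) ->
  inH (fun x => \sum_(i <- s) c i * F i x).
Proof.
move=> hF; apply/inHP; split.
  by apply: csqint_sum => i; apply: csqintZ; have [] := (inHP (F i)).1 (hF i).
move=> x nx; rewrite big1// => i _.
by have [_ ->//] := (inHP (F i)).1 (hF i); rewrite mulr0.
Qed.

Lemma fhat_linear z f g w : inH f -> inH g ->
  fhat (fun x => z * f x + g x) w = z * fhat f w + fhat g w.
Proof.
move=> hf hg; rewrite (fhat_cint _ (inH_linear z hf hg)) (fhat_cint _ hf) (fhat_cint _ hg).
have [sf _] := (inHP f).1 hf; have [sg _] := (inHP g).1 hg.
have se := csqint_conj (csqint_expw w).
rewrite -(cintM_const _ (cintegrableM sf se)).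
rewrite -(cintD (cintegrableM_const z (cintegrableM sf se)) (cintegrableM sg se)).
by apply: eq_cint => x _; rewrite mulrDl mulrA.
Qed.

End complex_integrals.

(** * Distance of the transform to its step function *)

Section derivative_bound.
Context {R : realType}.
Notation mu := (@lebesgue_measure R).
Notation D := (`[0, 1]%classic : set R).
Implicit Types p q : R -> R.

(** On [[0, 1]] the multiplier satisfies [(2 pi (x - 1/2)) ^+ 2 = pi ^+ 2 * (1 - 4 x (1 - x)) <= pi
    ^+ 2]. *)
Lemma nsq_dft_le p q : sqint p -> sqint q ->
  nsq (fun x => 2 * pi * (x - 2^-1) * q x) (fun x => - (2 * pi) * (x - 2^-1) * p x) <=
  pi ^+ 2 * nsq p q.
Proof.
move=> hp hq; have i1 := rint_nsq hp hq.
have e1 := RintegralZl (pi ^+ 2) measurable01 i1.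
apply: (@le_trans _ _ (\int[mu]_(x in D) (pi ^+ 2 * (p x ^+ 2 + q x ^+ 2)))); last first.
  by rewrite le_eqVlt; apply/orP; left; apply/eqP; exact: e1.
apply: le_Rintegral => //.
- by apply: rint_nsq; exact: sqint_dft.
- exact: rintZ.
move=> x; rewrite /= in_itv/= => /andP[x0 x1]; rewrite -subr_ge0.
rewrite (_ : _ - _ = pi ^+ 2 * (p x ^+ 2 + q x ^+ 2) * (4 * (x * (1 - x)))).
  apply: mulr_ge0; first by rewrite mulr_ge0 ?addr_ge0 ?sqr_ge0.
  by apply: mulr_ge0 => //; apply: mulr_ge0 => //; rewrite subr_ge0.
by move: (pi : R) => Q; field.
Qed.

Lemma rint_nft_shift s p q : sqint p -> sqint q -> rint mu setT (nft s p q).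
Proof.
move=> hp hq; apply: (eq_rint measurableT _ (rint_nft hp hq)) => w _.
by rewrite nft_shift.
Qed.

Lemma plancherel_shift s p q : sqint p -> sqint q ->
  \int[mu]_w nft s p q w = nsq p q.
Proof.
move=> hp hq; rewrite -(plancherel hp hq).
by apply: eq_Rintegral => w _; exact: nft_shift.
Qed.

(* Centring [0, 1] at [1 / 2] halves the size of the multiplier [x - s], which
   makes [pi] instead of [2 pi] the bound for the derivative. *)
Lemma deviation_ft_le p q (y c : nat -> R) n (delta : R) :
  sqint p -> sqint q -> 0 < delta ->
  (forall i, (i < n)%N -> y i <= c i <= y i.+1) ->
  (forall i, (i < n)%N -> c i - y i <= delta / 2) ->
  (forall i, (i < n)%N -> y i.+1 - c i <= delta / 2) ->
  deviation y c n (ft 2^-1 p q) (ft 2^-1 q (fun x => - p x)) <= delta ^+ 2 * nsq p q.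
Proof.
move=> hp hq d0 yc cy yc'.
(* Wirtinger's inequality is used for all [k] with [k * delta < pi]; in the limit its factor cancels
   the [pi ^+ 2] of the derivative bound. *)
apply: (@le_of_lt_ratio _ pi) => //; [exact: pi_gt0|exact: deviation_ge0|].
move=> k k0 kd.
pose p1 x := 2 * pi * (x - 2^-1) * q x.
pose q1 x := - (2 * pi) * (x - 2^-1) * p x.
have hp1 : sqint p1 by exact: sqint_dft.
have hq1 : sqint q1 by exact: sqint_dft.
have dA (x : R) := is_derive_ft 2^-1 x hp hq.
have dB (x : R) : is_derive x (1 : R) (ft 2^-1 q (fun x => - p x))
    (ft 2^-1 q1 (fun x => - p1 x) x).
  have := is_derive_ft 2^-1 x hq (sqintN hp).
  rewrite (@eq_ft _ _ _ _ q1 (fun x => - p1 x))// => z _; rewrite /q1 /p1; ring.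
have cA' : continuous (ft 2^-1 p1 q1) by exact: continuous_ft.
have cB' : continuous (ft 2^-1 q1 (fun x => - p1 x)).
  by apply: continuous_ft => //; exact: sqintN.
have cA := @continuous_ft R 2^-1 _ _ hp hq.
have cB := @continuous_ft R 2^-1 _ _ hq (sqintN hp).
have := deviation_le yc cy yc' cA cB dA cA' dB cB' k0 kd; move=> /le_trans; apply.
apply: le_trans (nsq_dft_le hp hq).
rewrite -(plancherel_shift 2^-1 hp1 hq1).
apply: Rintegral_le_setT; first exact: rint_nft_shift.
by move=> x; exact: nft_ge0.
Qed.

End derivative_bound.

(** * The Hermitian form of the sampling operator *)

Section sampling_operator.
Context {R : realType}.
Notation mu := (@lebesgue_measure R).
Notation D := (`[0, 1]%classic : set R).
Notation C := (complex R).
Notation re f := (fun x => complex.Re (f x)).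
Notation im f := (fun x => complex.Im (f x)).
Variables (K : R) (N : nat) (w : nat -> R).
Notation S := (Sop K N w).
Notation m := (weight K N w).
Notation s := (index_iota 1 N.+1).
Implicit Types f g : R -> C.

Lemma SopE f x : D x ->
  S f x = \sum_(n <- s) (Complex (m n) 0 * fhat f (w n)) * expw (w n) x.
Proof. by rewrite /= in_itv/= /Sop => ->. Qed.

Lemma inH_Sop f : inH (S f).
Proof.
apply/inHP; split; last first.
  by move=> x; rewrite /= in_itv/= /Sop => /negP/negbTE ->.
have [hr hi] : csqint (fun x => \sum_(n <- s)
    (Complex (m n) 0 * fhat f (w n)) * expw (w n) x).
  by apply: csqint_sum => n; apply: csqintZ; exact: csqint_expw.
by split; [apply: eq_sqint hr|apply: eq_sqint hi] => x Dx; rewrite SopE.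
Qed.

(** [ip (S f) g] and [ip f (S g)] are both computed as the same weighted sum of transforms, real
    weights being their own conjugates; self-adjointness follows. *)
Lemma ip_Sop_l f g : inH f -> inH g -> ip (S f) g =
  \sum_(n <- s) Complex (m n) 0 * fhat f (w n) * cconj (fhat g (w n)).
Proof.
move=> hf hg; have [sg _] := (inHP g).1 hg.
have ic n := cintegrableM sg (csqint_conj (csqint_expw (w n))).
have ic' n := cintegrableM (csqint_expw (w n)) (csqint_conj sg).
rewrite (ipE _ (inH_Sop f)).
rewrite (@eq_cint _ _ (fun x => \sum_(n <- s) (Complex (m n) 0 * fhat f (w n)) *
    (expw (w n) x * cconj (g x)))); last first.
  by move=> x Dx; rewrite SopE// mulr_suml; apply: eq_bigr => n _; rewrite mulrA.
rewrite cint_sum; last by move=> n; exact: cintegrableM_const.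
apply: eq_bigr => n _; rewrite cintM_const//; congr (_ * _).
rewrite (fhat_cint _ hg) -cint_conj//; apply: eq_cint => x _.
by rewrite cconjM cconjK mulrC.
Qed.

Lemma ip_Sop_r f g : inH f -> inH g -> ip f (S g) =
  \sum_(n <- s) Complex (m n) 0 * fhat f (w n) * cconj (fhat g (w n)).
Proof.
move=> hf hg; have [sf _] := (inHP f).1 hf.
have ic n := cintegrableM sf (csqint_conj (csqint_expw (w n))).
rewrite (ipE _ hf).
rewrite (@eq_cint _ _ (fun x => \sum_(n <- s) cconj (Complex (m n) 0 * fhat g (w n)) *
    (f x * cconj (expw (w n) x)))); last first.
  move=> x Dx; rewrite SopE// cconj_sum mulr_sumr; apply: eq_bigr => n _.
  by rewrite cconjM mulrCA.
rewrite cint_sum; last by move=> n; exact: cintegrableM_const.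
apply: eq_bigr => n _; rewrite cintM_const// -(fhat_cint _ hf) cconjM.
rewrite (_ : cconj (Complex (m n) 0) = Complex (m n) 0); last first.
  by apply: complexP => //=; rewrite oppr0.
by rewrite -!mulrA; congr (_ * _); rewrite mulrC.
Qed.

Lemma Re_ip_Sop f : inH f ->
  complex.Re (ip (S f) f) = \sum_(n <- s) m n * csq (fhat f (w n)).
Proof.
move=> hf; rewrite ip_Sop_l// Re_sum; apply: eq_bigr => n _.
by move: (fhat f (w n)) => F; rewrite !(ReM, ImM)/= /csq; ring.
Qed.

Lemma Sop_linear z f g : inH f -> inH g ->
  S (fun x => z * f x + g x) = (fun x => z * S f x + S g x).
Proof.
move=> hf hg; apply/funext => x; rewrite /Sop; case: ifP => _; last first.
  by rewrite mulr0 addr0.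
rewrite mulr_sumr -big_split/=; apply: eq_bigr => n _.
by rewrite fhat_linear//; ring.
Qed.

End sampling_operator.

(** * The Cauchy-Schwarz inequality for nonnegative weights *)

Section weighted_cauchy_schwarz.
Context {R : realType}.
Notation C := (complex R).

(** The quadratic will be [||r F - z G||^2] with [z = <F, G>] and [n = |z|^2]. Its value at the
    minimiser [r = n / U] is [n (U V - n) / U]; if [U = 0], taking [r = V + 1] forces [n = 0]. *)
Lemma discriminant_le (U V n : R) : 0 <= U -> 0 <= V -> 0 <= n ->
  (forall r, 0 <= r ^+ 2 * U - 2 * r * n + n * V) -> n <= U * V.
Proof.
move=> U0 V0 n0 H; have [->|np] := eqVneq n 0; first by rewrite mulr_ge0.
have npos : 0 < n by rewrite lt0r np.
have [Uz|Up] := eqVneq U 0.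
  have := H (V + 1); rewrite Uz mulr0 add0r mul0r.
  rewrite (_ : _ + _ = - (n * (V + 2))); last by ring.
  by rewrite oppr_ge0 leNgt mulr_gt0// ltr_wpDl.
have Upos : 0 < U by rewrite lt0r Up.
have := H (n / U).
rewrite (_ : _ + _ = n * (U * V - n) / U); last by field.
by rewrite pmulr_lge0 ?invr_gt0// pmulr_rge0// subr_ge0.
Qed.

Lemma weighted_cauchy_schwarz (s : seq nat) (m : nat -> R) (F G : nat -> C) :
  (forall i, i \in s -> 0 <= m i) ->
  csq (\sum_(i <- s) Complex (m i) 0 * F i * cconj (G i)) <=
  (\sum_(i <- s) m i * csq (F i)) * (\sum_(i <- s) m i * csq (G i)).
Proof.
move=> m0; set z := (\sum_(i <- s) _ * _ : C).
have nn (H : nat -> C) : 0 <= \sum_(i <- s) m i * csq (H i).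
  by rewrite big_seq; apply: sumr_ge0 => i /m0 h; rewrite mulr_ge0// addr_ge0 ?sqr_ge0.
apply: discriminant_le => //; first by rewrite addr_ge0 ?sqr_ge0.
move=> r; set x := complex.Re z; set y := complex.Im z.
have -> : csq z = x * x + y * y by rewrite /csq -!expr2.
have zx : x = \sum_(i <- s) m i * (complex.Re (F i) * complex.Re (G i) + complex.Im (F i) * complex.Im (G i)).
  by rewrite /x /z Re_sum; apply: eq_bigr => i _; rewrite !(ReM, ImM)/=; ring.
have zy : y = \sum_(i <- s) m i * (complex.Im (F i) * complex.Re (G i) - complex.Re (F i) * complex.Im (G i)).
  by rewrite /y /z Im_sum; apply: eq_bigr => i _; rewrite !(ReM, ImM)/=; ring.
(* The weighted squared norm of [r F - z G], with [z = x + i y]. *)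
have : 0 <= \sum_(i <- s) m i *
   ((r * complex.Re (F i) - (x * complex.Re (G i) - y * complex.Im (G i))) ^+ 2 +
    (r * complex.Im (F i) - (x * complex.Im (G i) + y * complex.Re (G i))) ^+ 2).
  by rewrite big_seq; apply: sumr_ge0 => i /m0 h; rewrite mulr_ge0// addr_ge0 ?sqr_ge0.
congr (_ <= _).
transitivity (r ^+ 2 * (\sum_(i <- s) m i * csq (F i)) - 2 * r * (x *
   (\sum_(i <- s) m i * (complex.Re (F i) * complex.Re (G i) + complex.Im (F i) * complex.Im (G i)))
   + y * \sum_(i <- s) m i * (complex.Im (F i) * complex.Re (G i) - complex.Re (F i) * complex.Im (G i)))
   + (x * x + y * y) * \sum_(i <- s) m i * csq (G i)); last by rewrite -zx -zy.
move: x y {zx zy} => x y.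
rewrite !mulr_sumr -big_split/= mulr_sumr -sumrB -big_split/=.
by apply: eq_bigr => i _; rewrite /csq; ring.
Qed.

End weighted_cauchy_schwarz.

(** * Energy bounds for dense frequencies *)

Section dense_sampling.
Context {R : realType}.
Notation mu := (@lebesgue_measure R).
Notation C := (complex R).
Notation re f := (fun x => complex.Re (f x)).
Notation im f := (fun x => complex.Im (f x)).
Variables (K delta : R) (N : nat) (w : nat -> R).
Hypothesis dense : KDdense K delta N w.
Notation S := (Sop K N w).
Notation wx := (wext K N w).
Implicit Types f g : R -> C.

Let d01 : 0 < delta < 1. Proof. by have [_ []] := dense. Qed.
Let N0 : (0 < N)%N. Proof. by have [_ [_ []]] := dense. Qed.
Let w_mono n m : (1 <= n)%N -> (n < m)%N -> (m <= N)%N -> w n < w m.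
Proof. by have [_ [_ [_ []]]] := dense => + _; exact. Qed.
Let wK n : (1 <= n <= N)%N -> - K <= w n <= K.
Proof. by have [_ [_ [_ [_ []]]]] := dense => + _; exact. Qed.
Let gap n : (n <= N)%N -> wx n.+1 - wx n <= delta.
Proof. by have [_ [_ [_ [_ []]]]] := dense => _; exact. Qed.

Let wxE n : (1 <= n <= N)%N -> wx n = w n.
Proof.
by case: n => [//|n] /andP[_ nN]; rewrite /wext/= eqSS ltn_eqF.
Qed.

Let wx0 : wx 0%N = w N - 2 * K. Proof. by []. Qed.
Let wxN : wx N.+1 = w 1%N + 2 * K. Proof. by rewrite /wext eqxx. Qed.

(** At both ends the order comes from the confinement to [[- K, K]]: two frequencies differ by at
    most [2 K]. *)
Let wx_le n : (n <= N)%N -> wx n <= wx n.+1.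
Proof.
have := wK (n := 1); have := wK (n := N); rewrite N0 leqnn => /(_ isT)/andP[? ?] /(_ isT)/andP[? ?].
case: n => [_|n nN].
  by rewrite wx0 wxE//; lra.
have [->|nN'] := eqVneq n.+1 N.
  by rewrite wxN wxE ?leqnn ?N0//; lra.
have nN2 : (n.+1 < N)%N by rewrite ltn_neqAle nN' nN.
by rewrite !wxE//; apply/ltW/w_mono.
Qed.

(** Cells are numbered from 0: cell [i] runs from [node i] to [node i.+1], contains the frequency
    [w i.+1], and has length [weight K N w i.+1]. *)
Definition node (i : nat) : R := (wx i + wx i.+1) / 2.
Definition center (i : nat) : R := w i.+1.

Let node_center i : (i < N)%N -> node i <= center i <= node i.+1.
Proof.
move=> iN; rewrite /node /center -(wxE (n := i.+1))//.
by have := wx_le (ltnW iN); have := wx_le iN => h1 h2; apply/andP; split; lra.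
Qed.

Let center_node i : (i < N)%N -> center i - node i <= delta / 2.
Proof.
move=> iN; rewrite /node /center -(wxE (n := i.+1))//.
by have := gap (ltnW iN) => h; lra.
Qed.

Let node_center' i : (i < N)%N -> node i.+1 - center i <= delta / 2.
Proof.
move=> iN; rewrite /node /center -(wxE (n := i.+1))//.
by have := gap iN => h; lra.
Qed.

Lemma weight_ge0 n : n \in index_iota 1 N.+1 -> 0 <= weight K N w n.
Proof.
rewrite mem_index_iota => /andP[]; case: n => // n _; rewrite ltnS => nN.
rewrite /weight/= divr_ge0// subr_ge0.
exact: le_trans (wx_le (ltnW nN)) (wx_le nN).
Qed.

(** The extreme nodes are [(w 1 + w N) / 2] minus and plus [K]. The gap [w 1 + 2 K - w N <= delta]
    puts [w 1] within [delta] of [- K] and [w N] within [delta] of [K], so this midpoint is at most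
    [delta / 2 < 1 / 2] away from 0. *)
Let nodes_cover : `](- (K - 2^-1)), (K - 2^-1)[%classic `<=` `[node 0, node N]%classic.
Proof.
have h1 := wK (n := 1); have hN := wK (n := N).
have {h1}/andP[? ?] := h1 (introT andP (conj isT N0)).
have {hN}/andP[? ?] : - K <= w N <= K by apply: hN; rewrite N0 leqnn.
have := gap (leqnn N); rewrite wxN (wxE (n := N)) ?N0 ?leqnn// => g.
have /andP[? ?] := d01.
have -> : node 0 = (w N + w 1%N) / 2 - K by rewrite /node wx0 (wxE (n := 1))//; field.
have -> : node N = (w N + w 1%N) / 2 + K.
  by rewrite /node wxN (wxE (n := N)) ?N0 ?leqnn//; field.
by move=> x /=; rewrite !in_itv/= => /andP[? ?]; apply/andP; split; lra.
Qed.

Definition energy f : R := complex.Re (ip (S f) f).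

Let A f := ft 2^-1 (re f) (im f).
Let B f := ft 2^-1 (im f) (fun x => - complex.Re (f x)).

Let energyE f : inH f -> energy f = sampled node center N (A f) (B f).
Proof.
move=> hf; have [[hr hi] _] := (inHP f).1 hf.
rewrite /energy Re_ip_Sop// big_add1/=; apply: eq_bigr => i _.
rewrite csq_fhat// -(nft_shift 2^-1 _ hr hi); congr (_ * _).
by rewrite /weight /node /=; field.
Qed.

Lemma energy_ge0 f : inH f -> 0 <= energy f.
Proof.
move=> hf; rewrite /energy Re_ip_Sop// big_seq.
by apply: sumr_ge0 => n /weight_ge0 h; rewrite mulr_ge0// addr_ge0 ?sqr_ge0.
Qed.

Let mass f := \int[mu]_(x in `[node 0, node N]) (A f x ^+ 2 + B f x ^+ 2).

Let mass_ge0 f : 0 <= mass f.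
Proof. by apply: Rintegral_ge0 => x _; rewrite addr_ge0 ?sqr_ge0. Qed.

Let mass_le f : inH f -> mass f <= l2norm f ^+ 2.
Proof.
move=> hf; have [[hr hi] _] := (inHP f).1 hf.
rewrite sqr_l2norm// -(plancherel_shift 2^-1 hr hi).
by apply: Rintegral_le_setT; [exact: rint_nft_shift|move=> x; exact: nft_ge0].
Qed.

Lemma l2norm_ge0 f : 0 <= l2norm f. Proof. exact: sqrtr_ge0. Qed.

Let dev_le f : inH f ->
  deviation node center N (A f) (B f) <= delta ^+ 2 * l2norm f ^+ 2.
Proof.
move=> hf; have [[hr hi] _] := (inHP f).1 hf; rewrite (sqr_l2norm hf).
by apply: deviation_ft_le => //; have /andP[] := d01.
Qed.

Let sqrt_dev f : Num.sqrt (delta ^+ 2 * l2norm f ^+ 2) = delta * l2norm f.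
Proof.
rewrite -exprMn sqrtr_sqr ger0_norm// mulr_ge0 ?l2norm_ge0//.
by have /andP[/ltW] := d01.
Qed.

Let cAB f : inH f -> continuous (A f) /\ continuous (B f).
Proof.
move=> hf; have [[hr hi] _] := (inHP f).1 hf.
by split; apply: continuous_ft => //; exact: sqintN.
Qed.

Let d2n f : 0 <= delta ^+ 2 * l2norm f ^+ 2.
Proof. by rewrite mulr_ge0 ?sqr_ge0. Qed.

Lemma energy_le f : inH f -> energy f <= (1 + delta) ^+ 2 * l2norm f ^+ 2.
Proof.
move=> hf; have [cA cB] := cAB hf.
have H t : 0 < t -> energy f <= (1 + t) * mass f + (1 + t^-1) * (delta ^+ 2 * l2norm f ^+ 2).
  move=> t0; rewrite energyE//.
  apply: (le_trans (sampled_le node_center cA cB t0)).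
  by rewrite lerD2l ler_wpM2l ?dev_le// addr_ge0// invr_ge0 ltW.
have := le_sqr_sqrtD (mass_ge0 f) (d2n f) H; rewrite sqrt_dev => /le_trans; apply.
rewrite -exprMn mulrDl mul1r ler_sqr ?nnegrE; last 2 first.
- by rewrite addr_ge0 ?sqrtr_ge0// mulr_ge0 ?l2norm_ge0//; have /andP[/ltW] := d01.
- by rewrite addr_ge0 ?l2norm_ge0// mulr_ge0 ?l2norm_ge0//; have /andP[/ltW] := d01.
rewrite lerD2r -[leRHS](ger0_norm (l2norm_ge0 f)) -sqrtr_sqr ler_sqrt ?sqr_ge0//.
exact: mass_le.
Qed.

(** The square of the quantity whose supremum over unit vectors is [residual] at [K - 1 / 2]. *)
Definition tail f : R :=
  \int[mu]_(x in ~` `](- (K - 2^-1)), (K - 2^-1)[%classic) csq (fhat f x).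

Let rint_csq_fhat f : inH f -> rint mu setT (fun x => csq (fhat f x)).
Proof.
move=> hf; have [[hr hi] _] := (inHP f).1 hf.
apply: (eq_rint measurableT _ (rint_nft hr hi)) => x _.
by rewrite csq_fhat.
Qed.

Let mJ : measurable (`](- (K - 2^-1)), (K - 2^-1)[%classic : set (measurableTypeR R)).
Proof. exact: measurable_itv. Qed.

Lemma tail_le f : inH f -> tail f <= l2norm f ^+ 2.
Proof.
move=> hf; have [[hr hi] _] := (inHP f).1 hf.
have -> : l2norm f ^+ 2 = \int[mu]_x csq (fhat f x).
  rewrite sqr_l2norm// -(plancherel hr hi).
  by apply: eq_Rintegral => x _; rewrite csq_fhat.
apply: Rintegral_le_subset => //; [exact: measurableC|exact: rint_csq_fhat|].
by move=> x; rewrite addr_ge0 ?sqr_ge0.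
Qed.

(** By Plancherel's theorem, what the tail misses lies on the central interval, which the cells
    cover. *)
Let mass_ge f : inH f -> l2norm f ^+ 2 - tail f <= mass f.
Proof.
move=> hf; have [[hr hi] _] := (inHP f).1 hf.
have hT := rint_csq_fhat hf.
have e : l2norm f ^+ 2 = \int[mu]_x csq (fhat f x).
  rewrite sqr_l2norm// -(plancherel hr hi).
  by apply: eq_Rintegral => x _; rewrite csq_fhat.
have e2 : \int[mu]_x csq (fhat f x) = tail f +
    \int[mu]_(x in `](- (K - 2^-1)), (K - 2^-1)[%classic) csq (fhat f x).
  rewrite -[in LHS](setvU `](- (K - 2^-1)), (K - 2^-1)[%classic).
  rewrite Rintegral_setU//; [exact: measurableC|by rewrite setvU|].
  by apply/disj_setPS => x [].
rewrite e e2 addrC addKr.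
have -> : mass f = \int[mu]_(x in `[node 0, node N]) csq (fhat f x).
  apply: eq_Rintegral => x _; rewrite csq_fhat//.
  exact: (nft_shift 2^-1 x hr hi).
have mI : measurable (`[node 0, node N]%classic : set (measurableTypeR R)).
  exact: measurable_itv.
apply: (Rintegral_le_subset mJ mI nodes_cover).
  exact: integrableS measurableT mI (@subsetT _ _) hT.
by move=> x; rewrite addr_ge0 ?sqr_ge0.
Qed.

Lemma energy_ge f (e : R) : inH f -> tail f <= e ^+ 2 * l2norm f ^+ 2 ->
  delta < Num.sqrt (1 - e ^+ 2) ->
  (Num.sqrt (1 - e ^+ 2) - delta) ^+ 2 * l2norm f ^+ 2 <= energy f.
Proof.
move=> hf tf dlt; have [cA cB] := cAB hf.
have dge0 : 0 <= delta by have /andP[/ltW] := d01.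
have H t : 0 < t -> mass f <= (1 + t) * energy f + (1 + t^-1) * (delta ^+ 2 * l2norm f ^+ 2).
  move=> t0; rewrite energyE//.
  apply: (le_trans (le_sampled node_center cA cB t0)).
  by rewrite lerD2l ler_wpM2l ?dev_le// addr_ge0// invr_ge0 ltW.
have := le_sqr_sqrtD (energy_ge0 hf) (d2n f) H; rewrite sqrt_dev => le1.
have le2 : (Num.sqrt (1 - e ^+ 2) * l2norm f) ^+ 2 <= mass f.
  (* [Num.sqrt] is 0 on negative numbers, so [0 <= delta < Num.sqrt (1 - e ^+ 2)] forces
     [1 - e ^+ 2 > 0]. *)
  rewrite exprMn sqr_sqrtr; last by apply: ltW; rewrite -sqrtr_gt0 (le_lt_trans dge0 dlt).
  by apply: le_trans (mass_ge hf); rewrite mulrBl mul1r lerD2l lerN2.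
have := le_trans le2 le1.
rewrite ler_sqr ?nnegrE; last 2 first.
- by rewrite mulr_ge0 ?sqrtr_ge0 ?l2norm_ge0.
- by rewrite addr_ge0 ?sqrtr_ge0// mulr_ge0 ?l2norm_ge0.
rewrite -lerBlDr -mulrBl => le3.
rewrite -exprMn -[leRHS](sqr_sqrtr (energy_ge0 hf)) ler_sqr ?nnegrE ?sqrtr_ge0//.
by rewrite mulr_ge0 ?l2norm_ge0// subr_ge0 ltW.
Qed.

Lemma cabs_ip_Sop f g : inH f -> inH g ->
  cabs (ip (S f) g) <= Num.sqrt (energy f * energy g).
Proof.
move=> hf hg; rewrite /cabs ler_sqrt; last by rewrite mulr_ge0 ?energy_ge0.
rewrite /energy !Re_ip_Sop// ip_Sop_l//.
by apply: weighted_cauchy_schwarz => n; exact: weight_ge0.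
Qed.

Lemma Re_le_cabs (z : C) : complex.Re z <= cabs z.
Proof.
rewrite /cabs (le_trans (ler_norm _))// -sqrtr_sqr ler_sqrt.
  by rewrite /csq lerDl sqr_ge0.
by rewrite addr_ge0 ?sqr_ge0.
Qed.

(** Cauchy-Schwarz for the form, applied to [f] and [S f], bounds [||S f||^2] by
    [(1 + delta)^2 ||f|| ||S f||]; one factor [||S f||] is then cancelled. *)
Lemma l2norm_Sop_le f : inH f -> l2norm (S f) <= (1 + delta) ^+ 2 * l2norm f.
Proof.
move=> hf; have hS : inH (S f) by exact: inH_Sop.
have n0 := l2norm_ge0 f; have nS0 := l2norm_ge0 (S f).
have c0 : 0 <= (1 + delta) ^+ 2 by exact: sqr_ge0.
have le1 : l2norm (S f) ^+ 2 <= (1 + delta) ^+ 2 * l2norm f * l2norm (S f).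
  rewrite -ip_self//; apply: le_trans (Re_le_cabs _) _.
  apply: le_trans (cabs_ip_Sop hf hS) _.
  have q0 : 0 <= (1 + delta) ^+ 2 * l2norm f * l2norm (S f).
    by apply: mulr_ge0 => //; exact: mulr_ge0.
  rewrite -[leRHS](ger0_norm q0) -sqrtr_sqr ler_sqrt ?sqr_ge0//.
  apply: le_trans (ler_pM (energy_ge0 hf) (energy_ge0 hS) (energy_le hf) (energy_le hS)) _.
  by rewrite le_eqVlt; apply/orP; left; apply/eqP; ring.
have [z|nz] := eqVneq (l2norm (S f)) 0; first by rewrite z mulr_ge0.
have npos : 0 < l2norm (S f) by rewrite lt0r nz.
by rewrite -(ler_pM2r npos) -expr2.
Qed.

End dense_sampling.

(** * The residual as a bound on a whole subspace *)

Section subspaces.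
Context {R : realType}.
Notation C := (complex R).
Variable T : set (R -> C).
Hypothesis hT : findim_subspace_H T.

Lemma subspace_inH f : T f -> inH f.
Proof. by have [n [b [hb ->]]] := hT => -[c ->]; exact: inH_sum. Qed.

Lemma subspaceZ z f : T f -> T (fun x => z * f x).
Proof.
have [n [b [hb ->]]] := hT => -[c ->]; exists (fun i => z * c i).
apply/funext => x; rewrite mulr_sumr.
by apply: eq_bigr => i _; rewrite mulrA.
Qed.

Lemma inHZ (z : C) f : inH f -> inH (fun x => z * f x).
Proof.
move=> /inHP[hf f0]; apply/inHP; split; first exact: csqintZ.
by move=> x nx; rewrite f0// mulr0.
Qed.

Lemma csqM (z1 z2 : C) : csq (z1 * z2) = csq z1 * csq z2.
Proof. by rewrite /csq ReM ImM; ring. Qed.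

Lemma sqr_l2normZ (z : C) f : inH f ->
  l2norm (fun x => z * f x) ^+ 2 = csq z * l2norm f ^+ 2.
Proof.
move=> hf; rewrite (sqr_l2norm (inHZ z hf)) (sqr_l2norm hf).
have [[hr hi] _] := (inHP f).1 hf.
have e := RintegralZl (csq z) measurable01 (rint_nsq hr hi).
refine (etrans _ e); apply: eq_Rintegral => x _.
exact: csqM z (f x).
Qed.

Lemma fhatZ (z : C) f v : inH f -> fhat (fun x => z * f x) v = z * fhat f v.
Proof.
move=> hf; rewrite (fhat_cint _ (inHZ z hf)) (fhat_cint _ hf).
have [sf _] := (inHP f).1 hf.
rewrite -(cintM_const _ (cintegrableM sf (csqint_conj (csqint_expw v)))).
by apply: eq_cint => x _; rewrite mulrA.
Qed.

Lemma tailZ (K : R) (z : C) f : inH f ->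
  tail K (fun x => z * f x) = csq z * tail K f.
Proof.
move=> hf; have [[hr hi] _] := (inHP f).1 hf.
have mJ : measurable (~` `](- (K - 2^-1)), (K - 2^-1)[%classic : set (measurableTypeR R)).
  by apply: measurableC; exact: measurable_itv.
have i : rint (@lebesgue_measure R) (~` `](- (K - 2^-1)), (K - 2^-1)[%classic)
    (fun x => csq (fhat f x)).
  apply: (eq_rint mJ _ (integrableS measurableT mJ (@subsetT _ _) (rint_nft hr hi))) => x _.
  by rewrite csq_fhat.
refine (etrans _ (RintegralZl (csq z) mJ i)).
by apply: eq_Rintegral => x _; rewrite fhatZ// csqM.
Qed.

(** Both sides are homogeneous of degree 2, so [f] is normalised; when its norm is 0, so is its
    tail. *)
Lemma tail_le_residual (K : R) f : T f ->
  tail K f <= residual T (K - 2^-1) ^+ 2 * l2norm f ^+ 2.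
Proof.
move=> Tf; have hf := subspace_inH Tf.
have tail0 g : 0 <= tail K g.
  by apply: Rintegral_ge0 => x _; rewrite addr_ge0 ?sqr_ge0.
have [n0|n0] := eqVneq (l2norm f) 0.
  by rewrite n0 expr0n/= mulr0 -[leRHS](expr0n _ 2) -{1}n0 tail_le.
have npos : 0 < l2norm f by rewrite lt0r n0 l2norm_ge0.
pose z : C := Complex (l2norm f)^-1 0.
have cz : csq z = (l2norm f ^+ 2)^-1 by rewrite /csq/= expr0n addr0 exprVn.
pose g x := z * f x.
have Tg : T g by exact: subspaceZ.
have ng : l2norm g = 1.
  have e : l2norm g ^+ 2 = 1.
    by rewrite sqr_l2normZ// cz mulVf// sqrf_eq0.
  by apply/eqP; rewrite -(eqrXn2 (ltn0Sn 1)) ?l2norm_ge0// e expr1n.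
have le1 : Num.sqrt (tail K g) <= residual T (K - 2^-1).
  apply: ub_le_sup; last by exists g.
  (* Plancherel's theorem bounds the set by 1, so its [sup] is a true supremum and not a default
     value. *)
  exists 1 => _ [h [Th [nh ->]]].
  rewrite -[leRHS]sqrtr1 ler_sqrt//.
  by have := tail_le K (subspace_inH Th); rewrite nh expr1n.
have : tail K g <= residual T (K - 2^-1) ^+ 2.
  rewrite -(sqr_sqrtr (tail0 g)) ler_sqr ?nnegrE ?sqrtr_ge0//.
  exact: le_trans (sqrtr_ge0 _) le1.
by rewrite tailZ// cz mulrC ler_pdivrMr// exprn_gt0.
Qed.

End subspaces.

(** * Admissibility and the reconstruction constant *)

Theorem theorem4p5 (R : realType) (T : set (R -> complex R))
    (K delta : R) (N : nat) (w : nat -> R) :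
  findim_subspace_H T ->
  KDdense K delta N w ->
  delta < Num.sqrt (1 - residual T (K - 2^-1) ^+ 2) ->
  admissible (Omega_set N w) T (Sop K N w) /\
  recon_const T (Sop K N w) <=
    (1 + delta) / (Num.sqrt (1 - residual T (K - 2^-1) ^+ 2) - delta).
Proof.
move=> hT dense dlt.
set r := Num.sqrt (1 - residual T (K - 2^-1) ^+ 2) in dlt *.
have d0 : 0 < delta by have [_ [/andP[]]] := dense.
have c0 : 0 < r - delta by rewrite subr_gt0.
have lower f : T f -> (r - delta) ^+ 2 * l2norm f ^+ 2 <= complex.Re (ip (Sop K N w f) f).
  move=> Tf; have hf := subspace_inH hT Tf.
  exact: (energy_ge dense hf (tail_le_residual hT K Tf) dlt).
split.
  split; [|split; [|split; [|split; [|split; [|split]]]]].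
  - by move=> f _; exact: inH_Sop.
  - by move=> a f g hf hg; exact: Sop_linear.
  - by exists ((1 + delta) ^+ 2) => f hf; exact: (l2norm_Sop_le dense).
  - move=> f g hf hg fg; apply/funext => x; rewrite /Sop; case: ifP => // _.
    rewrite big_nat_cond [RHS]big_nat_cond; apply: eq_bigr => n.
    by rewrite andbT ltnS => nN; rewrite fg//; exists n.
  - by move=> f g hf hg; rewrite ip_Sop_l// ip_Sop_r.
  - by move=> f g hf hg; exact: (cabs_ip_Sop dense).
  - by exists ((r - delta) ^+ 2); split; [rewrite exprn_gt0|].
rewrite /recon_const.
have C2 : C2const (Sop K N w) <= (1 + delta) ^+ 2.
  rewrite /C2const; set X := [set c | _].
  have Xd : X ((1 + delta) ^+ 2) by move=> f hf; exact: (energy_le dense).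
  (* Without a lower bound, [inf] has the default value 0, which satisfies the estimate too. *)
  have [lb|nlb] := pselect (has_lbound X); first exact: ge_inf.
  by rewrite inf_out ?sqr_ge0// => -[].
rewrite /C1const; set Y := [set c | _].
have Yc : Y ((r - delta) ^+ 2) by exact: lower.
have q0 : 0 <= (1 + delta) / (r - delta).
  by rewrite divr_ge0 ?ltW// addr_gt0.
(* [Y] is unbounded when [T] has only vectors of norm 0. Then [sup Y] is 0 by default, the quotient
   by 0 is 0, and the bound holds because its right side is nonnegative. *)
have [ub|nub] := pselect (has_ubound Y); last first.
  by rewrite sup_out ?invr0 ?mulr0 ?sqrtr0// => -[].
have C1 : (r - delta) ^+ 2 <= sup Y by exact: ub_le_sup.
have C1pos : 0 < sup Y by rewrite (lt_le_trans _ C1)// exprn_gt0.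
rewrite -[leRHS](ger0_norm q0) -sqrtr_sqr ler_sqrt ?sqr_ge0// expr_div_n.
rewrite ler_pdivrMr// -mulrA.
apply: (le_trans C2); rewrite ler_peMr ?sqr_ge0//.
by rewrite mulrC ler_pdivlMr ?mul1r// exprn_gt0.
Qed.
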